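(* (i) $\mathrm{ES}(6,2\mathcal{C}_{\ge3})=[10,12]$. (ii) For every integer $n\ge 7$, $$\mathrm{ES}(n,2\mathcal{C}_{\ge3})=[n+5,2n-2]\cup\{n+2t: t\in[3,n-3]\}.$$ Equivalently, for $n\ge7$ and $m\in[n+5,3n-6]$, there is an $n$-vertex $2\mathcal{C}_{\ge3}$-saturated graph with $m$ edges if and only if $m\in[n+5,2n-2]$ or $m-n$ is even.
   Context: All graphs are finite and simple. For integers $a\le b$, $[a,b]=\{a,a+1,\dots,b\}$. For a family $\mathcal{H}$ of graphs, a graph $G$ is $\mathcal{H}$-saturated if $G$ contains no subgraph isomorphic to a member of $\mathcal{H}$, but for every pair of non-adjacent vertices $u,v$ the graph $G+uv$ contains a subgraph isomorphic to some member of $\mathcal{H}$. The saturation spectrum $\mathrm{ES}(n,\mathcal{H})$ is the set of all numbers of edges $|E(G)|$ over all $n$-vertex $\mathcal{H}$-saturated graphs $G$. $k\mathcal{C}_{\ge3}$ is the family of all vertex-disjoint unions of $k$ (not necessarily distinct) cycles (of length at least $3$); so a graph is $2\mathcal{C}_{\ge3}$-saturated iff it has no two vertex-disjoint cycles but adding any non-edge creates two vertex-disjoint cycles. *)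

(* Defs.v *)
From HB Require Import structures.
From mathcomp Require Import all_boot.

Set Implicit Arguments.
Unset Strict Implicit.
Unset Printing Implicit Defensive.

Record sgraph := SGraph {
  vertex :> finType;
  adj : rel vertex;
  adj_sym : symmetric adj;
  adj_irr : irreflexive adj
}.

Definition edges (G : sgraph) : {set {set G}} :=
  [set [set p.1; p.2] | p : G * G & adj p.1 p.2].

Definition isomorphic (G H : sgraph) : Prop :=
  exists2 f : G -> H, bijective f & forall x y, adj (f x) (f y) = adj x y.

(* H embeds in G as a subgraph, not necessarily an induced one. *)
Definition contains_copy (G H : sgraph) : Prop :=
  exists2 f : H -> G, injective f & forall x y, adj x y -> adj (f x) (f y).

Section AddEdge.
Variables (G : sgraph) (u v : G).

(* The guard x != y makes the operation total: G + uu is G. *)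
Definition add_edge_adj : rel G :=
  fun x y => adj x y ||
    (x != y) && (((x == u) && (y == v)) || ((x == v) && (y == u))).

Fact add_edge_sym : symmetric add_edge_adj.
Proof.
move=> x y; rewrite /add_edge_adj (adj_sym x y) (eq_sym x y); congr (_ || (_ && _)).
by rewrite orbC (andbC (x == v)) (andbC (x == u)).
Qed.

Fact add_edge_irr : irreflexive add_edge_adj.
Proof. by move=> x; rewrite /add_edge_adj adj_irr eqxx. Qed.

Definition add_edge : sgraph := SGraph add_edge_sym add_edge_irr.
End AddEdge.

Section CycleGraph.
Variable l : nat.

(* ordS is the successor modulo l.  This is the cycle C_l only for 3 <= l;
   the guard x != y matters only for l = 1. *)
Definition cycle_adj : rel 'I_l :=
  fun x y => (x != y) && ((y == ordS x) || (x == ordS y)).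

Fact cycle_adj_sym : symmetric cycle_adj.
Proof. by move=> x y; rewrite /cycle_adj eq_sym orbC. Qed.

Fact cycle_adj_irr : irreflexive cycle_adj.
Proof. by move=> x; rewrite /cycle_adj eqxx. Qed.

Definition cycle_graph : sgraph := SGraph cycle_adj_sym cycle_adj_irr.
End CycleGraph.

Section DisjointUnion.
Variables (I : finType) (F : I -> sgraph).

(* For tag x = tag y, tagged_as x y is the second component of y transported
   to the type of that of x. *)
Definition dunion_adj : rel {i : I & F i} :=
  fun x y => (tag x == tag y) && adj (tagged x) (tagged_as x y).

Fact dunion_sym : symmetric dunion_adj.
Proof.
move=> [i x] [j y]; rewrite /dunion_adj /=; have [eq_ij|ne_ij] := eqVneq i j.
  by case: j / eq_ij y => y; rewrite !tagged_asE adj_sym.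
by [].
Qed.

Fact dunion_irr : irreflexive dunion_adj.
Proof. by move=> [i x]; rewrite /dunion_adj /= tagged_asE adj_irr andbF. Qed.

Definition dunion : sgraph := SGraph dunion_sym dunion_irr.
End DisjointUnion.

Definition graph_family := sgraph -> Prop.

Definition contains_member (F : graph_family) (G : sgraph) : Prop :=
  exists2 H : sgraph, F H & contains_copy G H.

Definition saturated (F : graph_family) (G : sgraph) : Prop :=
  ~ contains_member F G /\
  forall u v : G, u != v -> ~~ adj u v -> contains_member F (add_edge u v).

Definition ES (n : nat) (F : graph_family) (m : nat) : Prop :=
  exists G : sgraph, [/\ #|G| = n, saturated F G & #|edges G| = m].

Definition cycles_ge3 (k : nat) : graph_family := fun H =>
  exists2 l : 'I_k -> nat, forall i, 3 <= l i &
    isomorphic H (dunion (fun i => cycle_graph (l i))).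

(* Main.v *)
(* Everything is expressed by counting: a nonempty vertex set with at least as many edges as
   vertices contains a cycle, so a graph has two disjoint cycles iff it has two disjoint such sets.

   Let G be saturated on n >= 6 vertices with m edges.  If no two vertices meet all the cycles,
   deleting vertices of degree 1 and suppressing those of degree 2 leads to minimum degree 3; a
   shortest cycle C then has length 3 or 4, G - C is a tree, length 4 yields a pair of vertices
   meeting all cycles, and length 3 forces exactly six edges between C and the tree, so
   m = n + 5.  Otherwise {x, y} meets all the cycles.  If G - x is acyclic, then saturation makes
   x universal and G - x a tree, so m = 2n - 3, and such a G needs n >= 8.  If G - x has just one
   cycle R, saturation joins x to all of R and m = n - 1 + deg x.  If both G - x and G - y have
   more cycles, then orienting each edge of the forest G - {x, y} towards the side that carries a
   cycle through x gives a sink z such that every cycle meets {x, y, z} at least twice; by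
   saturation every component of G - {x, y, z} sends exactly one edge to each of x, y, z, so
   m = n + 2k, where k is the number of components.  The last structure also excludes the small
   values of m in the case of a single cycle; and k = 2 is impossible, because joining suitable
   vertices of the two components only gives a subdivision of K5 with pendant trees. *)
Require Import Defs.
From mathcomp Require Import all_boot.
From mathcomp Require Import zify.

Set Implicit Arguments.
Unset Strict Implicit.
Unset Printing Implicit Defensive.

(** The invariant throughout is the excess of edges over vertices. It never drops when a connected
    set absorbs one more vertex, and suppressing a vertex of degree 2 leaves it unchanged; hence one
    core of excess 5 fixes the edge number when no two vertices meet all cycles. A non-edge uv
    creates a cycle only inside a set that contains u and v and lacks at most one edge to have as
    many edges as vertices. Saturation thus provides a tree through u and v that avoids a cycle
    already present, and most structural facts come from choosing uv so that such a pair cannot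
    exist. The sink z is found without an orientation: among the heavy parts of the forest that are
    attached by at most one edge, take a smallest one and the end in it of the leaving edge. The
    same extremal choice, with another notion of heavy, gives the two vertices whose joining
    excludes k = 2. For n = 6 the interval [n + 5, 2n - 2] is empty, so 10 and 11 arise separately,
    from the wheel with five spokes and from K5 with a pendant vertex. *)

Ltac set_cases :=
  repeat (rewrite ?eqxx //=; match goal with
  | H : is_true (?a != ?b) |- context [?a == ?b] => rewrite (negPf H)
  | H : is_true (?a != ?b) |- context [?b == ?a] => rewrite (eq_sym b a) (negPf H)
  | |- context [?z == ?v] => let E := fresh "E" in case: (eqVneq z v) => [E|_]; [rewrite ?E|] => //=
  | |- context [?z \in ?A] => case: (z \in A) => //=
  end).

Ltac use_at z :=
  repeat match goal with
  | H : is_true (?A \subset ?B) |- _ => move: (introT implyP (subsetP H z)); clear H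
  | H : is_true [disjoint ?A & ?B] |- _ =>
      move: (H); rewrite disjoint_subset; move=> /subsetP /(_ z) /implyP; clear H
  end;
  repeat match goal with
  | H : is_true (_ \in _) |- _ => move: H
  | H : is_true (_ \notin _) |- _ => move: H
  end.

Ltac set_auto :=
  let z := fresh "z" in
  match goal with
  | |- is_true (_ \subset _) => apply/subsetP=> z
  | |- is_true [disjoint _ & _] => rewrite disjoint_subset; apply/subsetP=> z
  | |- _ = _ => apply/setP=> z
  end; use_at z; rewrite ?inE; set_cases.

(* Only arithmetic hypotheses are kept: lia would split on the set-theoretic ones. *)
Ltac nlia :=
  intros;
  repeat match goal with
  | H : is_true (_ <= _) |- _ => revert H
  | H : is_true (~~ (_ <= _)) |- _ => revert H
  | H : @eq ?T _ _ |- _ => unify T nat; revert H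
  end;
  clear;
  repeat match goal with X := _ |- _ => subst X end;
  intros; lia.

(** * Edge counts by degree sums, forests and minimal cycles *)

Section Counting.
Variable G : sgraph.
Implicit Types (A B C D E F K U W : {set G}) (u v w x y z : G).

(** Degree sums replace edge sets: every count is additive over disjoint unions, and no halves
    occur, since an edge inside A contributes 2 to [darts A]. *)
Definition deg v A : nat := \sum_(y in A) adj v y.
Definition arcs A B : nat := \sum_(x in A) deg x B.
Definition darts A : nat := arcs A A.

Lemma arcsC A B : arcs A B = arcs B A.
Proof.
rewrite /arcs /deg exchange_big /=; apply: eq_bigr => x _.
by apply: eq_bigr => y _; rewrite adj_sym.
Qed.

Lemma arcs1 v A : arcs [set v] A = deg v A.
Proof. by rewrite /arcs big_set1. Qed.

Lemma arcs0 A : arcs set0 A = 0.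
Proof. by rewrite /arcs big_set0. Qed.

Lemma deg0 v : deg v set0 = 0.
Proof. by rewrite /deg big_set0. Qed.

Lemma arcsU A B C : [disjoint A & B] -> arcs (A :|: B) C = arcs A C + arcs B C.
Proof.
by move=> dAB; rewrite /arcs -bigU //; apply: eq_bigl => x; rewrite !inE.
Qed.

Lemma arcsUr A B C : [disjoint A & B] -> arcs C (A :|: B) = arcs C A + arcs C B.
Proof. by move=> dAB; rewrite arcsC arcsU // arcsC (arcsC B). Qed.

Lemma arcs1U v A C : v \notin A -> arcs (v |: A) C = deg v C + arcs A C.
Proof. by move=> vA; rewrite arcsU ?arcs1 // disjoints1. Qed.

Lemma degU v A B : [disjoint A & B] -> deg v (A :|: B) = deg v A + deg v B.
Proof. by move=> dAB; rewrite -!arcs1 arcsUr. Qed.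

Lemma degU1 v w A : w \notin A -> deg v (w |: A) = adj v w + deg v A.
Proof. by move=> wA; rewrite degU ?disjoints1 // {1}/deg big_set1. Qed.

Lemma arcsD A B C : B \subset A -> arcs A C = arcs B C + arcs (A :\: B) C.
Proof.
move=> sBA; rewrite -arcsU; last by set_auto.
by congr (arcs _ _); set_auto.
Qed.

Lemma degD v A B : B \subset A -> deg v A = deg v B + deg v (A :\: B).
Proof.
move=> sBA; rewrite -degU; last by set_auto.
by congr (deg _ _); set_auto.
Qed.

Lemma arcsS A B C D : A \subset C -> B \subset D -> arcs A B <= arcs C D.
Proof.
move=> sAC sBD; rewrite (arcsD _ sAC) arcsC [X in _ <= X + _]arcsC (arcsD _ sBD).
nlia.
Qed.

Lemma degS v A B : A \subset B -> deg v A <= deg v B.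
Proof. by move=> sAB; rewrite -!arcs1 arcsS. Qed.

Lemma deg_arcs v A B : v \in A -> deg v B <= arcs A B.
Proof. by move=> vA; rewrite -arcs1 arcsS // sub1set. Qed.

Lemma degE v A : deg v A = #|[set y in A | adj v y]|.
Proof.
rewrite /deg -sum1_card big_mkcond /= [RHS]big_mkcond /=.
by apply: eq_bigr => y _; rewrite inE; case: (y \in A); case: (adj v y).
Qed.

Lemma deg_gt0P v A : reflect (exists2 u, u \in A & adj v u) (0 < deg v A).
Proof.
rewrite degE; apply: (iffP card_gt0P) => [[u]|[u uA vu]].
  by rewrite inE => /andP[]; exists u.
by exists u; rewrite inE uA.
Qed.

Lemma deg_gt1P v A :
  reflect (exists u w, [/\ u \in A, w \in A, u != w, adj v u & adj v w]) (1 < deg v A).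
Proof.
rewrite degE; apply: (iffP card_gt1P) => [[u [w []]]|[u [w [uA wA uw vu vw]]]].
  by rewrite !inE => /andP[uA vu] /andP[wA vw] uw; exists u, w.
by exists u, w; rewrite !inE uA wA vu vw.
Qed.

Lemma deg_le1 v A :
  (forall u w, u \in A -> w \in A -> adj v u -> adj v w -> u = w) -> deg v A <= 1.
Proof.
move=> uniq_nbr; rewrite leqNgt; apply/deg_gt1P=> -[u [w [uA wA uw vu vw]]].
by move/eqP: uw; apply; apply: uniq_nbr.
Qed.

Lemma arcs_gt0P A B :
  reflect (exists x y, [/\ x \in A, y \in B & adj x y]) (0 < arcs A B).
Proof.
apply: (iffP idP) => [|[x [y [xA yB xy]]]].
  rewrite lt0n sum_nat_eq0 negb_forall => /existsP[x].
  rewrite negb_imply -lt0n => /andP[xA /deg_gt0P[y yB xy]].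
  by exists x, y.
by apply: leq_trans (deg_arcs B xA); apply/deg_gt0P; exists y.
Qed.

Lemma arcs_eq0 x y A B : arcs A B = 0 -> x \in A -> y \in B -> adj x y = false.
Proof.
move=> a0 xA yB; apply/negP=> xy; suff: 0 < arcs A B by rewrite a0.
by apply/arcs_gt0P; exists x, y.
Qed.

Lemma darts_U A B :
  [disjoint A & B] -> darts (A :|: B) = darts A + darts B + 2 * arcs A B.
Proof.
move=> dAB; rewrite /darts arcsU // !arcsUr // (arcsC B A); nlia.
Qed.

Lemma dartsD A B : B \subset A ->
  darts A = darts B + darts (A :\: B) + 2 * arcs B (A :\: B).
Proof.
move=> sBA; rewrite -darts_U; last by set_auto.
by congr (darts _); set_auto.
Qed.

Lemma darts1 v : darts [set v] = 0.
Proof. by rewrite /darts arcs1 /deg big_set1 adj_irr. Qed.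

Lemma darts0 : darts set0 = 0.
Proof. exact: arcs0. Qed.

Lemma darts_U1 v A : v \notin A -> darts (v |: A) = darts A + 2 * deg v A.
Proof. by move=> vA; rewrite darts_U ?disjoints1 // darts1 arcs1. Qed.

Lemma degD1 v A : deg v (A :\ v) = deg v A.
Proof.
case: (boolP (v \in A)) => vA; last by congr (deg _ _); set_auto.
by rewrite -{2}(setD1K vA) degU1 ?setD11 // adj_irr.
Qed.

Lemma darts_D1 v A : v \in A -> darts A = darts (A :\ v) + 2 * deg v A.
Proof. by move=> vA; rewrite -{1}(setD1K vA) darts_U1 ?setD11 // degD1. Qed.

Lemma dartsS A B : A \subset B -> darts A <= darts B.
Proof. by move=> sAB; apply: arcsS. Qed.

(** Edges between the two set differences are counted only in the union. *)
Lemma darts_supermod A B : darts A + darts B <= darts (A :|: B) + darts (A :&: B).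
Proof.
have sAU : A \subset A :|: B by apply: subsetUl.
have sIB : A :&: B \subset B by apply: subsetIr.
have dif : (A :|: B) :\: A = B :\: (A :&: B) by set_auto.
rewrite (dartsD sAU) (dartsD sIB) dif.
have : arcs (A :&: B) (B :\: (A :&: B)) <= arcs A (B :\: (A :&: B)).
  by apply: arcsS; rewrite ?subsetIl.
nlia.
Qed.

(** Parity turns a strict inequality between [darts] and an even number into a gap of 2, that is, of
    one edge. *)
Lemma odd_darts A : odd (darts A) = false.
Proof.
elim: {A}#|A| {-2}A (erefl #|A|) => [|n IHn] A cA.
  by move/eqP: cA; rewrite cards_eq0 => /eqP->; rewrite darts0.
have /card_gt0P[v vA] : 0 < #|A| by rewrite cA.
rewrite (darts_D1 vA) oddD mul2n odd_double addbF IHn //.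
by move: (cardsD1 v A); rewrite vA cA => -[].
Qed.

Lemma darts2 u v : adj u v -> darts [set u; v] = 2.
Proof.
move=> uv; have neq : u != v by apply: contraTneq uv => ->; rewrite adj_irr.
by rewrite darts_U1 ?inE // darts1 /deg big_set1 uv.
Qed.

Lemma darts_gt0P A :
  reflect (exists x y, [/\ x \in A, y \in A & adj x y]) (0 < darts A).
Proof. exact: arcs_gt0P. Qed.

Lemma card_D A B : B \subset A -> #|A| = #|B| + #|A :\: B|.
Proof. by move=> sBA; rewrite -(cardsID B A) (setIidPr sBA). Qed.

Lemma card_disjU A B : [disjoint A & B] -> #|A :|: B| = #|A| + #|B|.
Proof. by move=> dAB; rewrite cardsU disjoint_setI0 // cards0 subn0. Qed.

Lemma adj_neq u v : adj u v -> u != v.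
Proof. by apply: contraTneq => ->; rewrite adj_irr. Qed.

(* darts A is twice the number of edges inside A, so a cycle is detected by 2 * #|B| <= darts B. *)
Definition cyc A := [exists B : {set G}, [&& B \subset A, B != set0 & 2 * #|B| <= darts B]].

Lemma cycI B A : B \subset A -> B != set0 -> 2 * #|B| <= darts B -> cyc A.
Proof. by move=> *; apply/existsP; exists B; apply/and3P. Qed.

Lemma cycS A B : A \subset B -> cyc A -> cyc B.
Proof.
move=> sAB /existsP[D /and3P[sD D0 DD]]; apply: (cycI _ D0 DD).
exact: subset_trans sAB.
Qed.

Lemma acycS A B : A \subset B -> ~~ cyc B -> ~~ cyc A.
Proof. by move/cycS/contra. Qed.

Lemma acyc_darts A : ~~ cyc A -> A != set0 -> darts A + 2 <= 2 * #|A|.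
Proof.
move=> acA A0; have: ~~ (2 * #|A| <= darts A) by apply: contra acA => /cycI->.
move: (odd_darts A); lia.
Qed.

Lemma acyc_darts_le A : ~~ cyc A -> darts A <= 2 * #|A|.
Proof.
move=> acA; case: (eqVneq A set0) => [->|A0]; first by rewrite darts0.
by have := acyc_darts acA A0; nlia.
Qed.

Lemma acyc1 v : ~~ cyc [set v].
Proof.
apply/negP=> /existsP[B /and3P[sB B0]]; rewrite -card_gt0 in B0 *.
by have := dartsS sB; rewrite darts1; nlia.
Qed.

Lemma acyc_leaf A : ~~ cyc A -> A != set0 -> exists2 v, v \in A & deg v A <= 1.
Proof.
move=> acA A0; apply/exists_inP; apply: contraNT acA => /exists_inPn noleaf.
apply: (cycI _ A0) => //; rewrite mulnC -sum_nat_const /darts /arcs.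
by apply: leq_sum => v /noleaf; rewrite -ltnNge.
Qed.

Lemma cyc_core A B : B \subset A -> B != set0 -> (forall v, v \in B -> 2 <= deg v B) -> cyc A.
Proof.
move=> sBA B0 dB; apply: cycS sBA _; apply: contraT => acB.
by have [v vB dv] := acyc_leaf acB B0; have := dB v vB; nlia.
Qed.

(** These are the vertex sets of induced cycles: by [mincyc_deg] they induce 2-regular graphs, and
    no proper subset carries a cycle. *)
Definition mincyc A :=
  [&& A != set0, 2 * #|A| <= darts A & [forall (B : {set G} | B \proper A), ~~ cyc B]].

Lemma mincyc_exists A : cyc A -> exists2 C : {set G}, C \subset A & mincyc C.
Proof.
move=> /existsP[B /and3P[sBA B0 BB]].
pose P (B : {set G}) := [&& B \subset A, B != set0 & 2 * #|B| <= darts B].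
have PB : P B by apply/and3P.
case: (arg_minnP (fun B : {set G} => #|B|) PB) => C /and3P[sCA C0 CC] minC.
exists C => //; apply/and3P; split=> //; apply/forall_inP=> D pDC.
apply/negP=> /existsP[E /and3P[sED E0 EE]].
have: #|C| <= #|E|.
  apply: minC; apply/and3P; split=> //.
  by apply: subset_trans sED (subset_trans (proper_sub pDC) sCA).
by rewrite leqNgt (leq_ltn_trans (subset_leq_card sED)) // proper_card.
Qed.

Section MinCyc.
Variable C : {set G}.
Hypothesis mC : mincyc C.

Lemma mincyc_neq0 : C != set0. Proof. by case/and3P: mC. Qed.

Lemma mincyc_cyc : cyc C.
Proof. by case/and3P: mC => C0 CC _; apply: cycI CC. Qed.

Lemma mincyc_proper B : B \proper C -> ~~ cyc B.
Proof. by case/and3P: mC => _ _ /forall_inP; apply. Qed.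

Lemma mincyc_D1 v : v \in C -> ~~ cyc (C :\ v).
Proof. by move=> vC; apply: mincyc_proper; rewrite properD1. Qed.

Lemma mincyc_deg_le v : v \in C -> 2 <= deg v C.
Proof.
move=> vC; case/and3P: mC => C0 CC _.
move: (mincyc_D1 vC) CC; rewrite (darts_D1 vC) (cardsD1 v C) vC -degD1.
case: (eqVneq (C :\ v) set0) => [->|C'0] acC; first by rewrite darts0 cards0 deg0.
by have := acyc_darts acC C'0; nlia.
Qed.

Lemma mincyc_card : 3 <= #|C|.
Proof.
case/set0Pn: mincyc_neq0 => v vC.
have /deg_gt1P[u [w [uC wC uw vu vw]]] := mincyc_deg_le vC.
have sC : [set v; u; w] \subset C by rewrite !subUset !sub1set vC uC.
apply: leq_trans (subset_leq_card sC).
by rewrite -setUA cardsU1 !inE cards2 uw negb_or !adj_neq.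
Qed.

Lemma mincyc_D1_neq0 v : C :\ v != set0.
Proof. by rewrite -card_gt0; have := mincyc_card; rewrite (cardsD1 v C); nlia. Qed.

Lemma mincyc_darts : darts C = 2 * #|C|.
Proof.
apply/eqP; rewrite eqn_leq andbC; case/and3P: (mC) => _ -> _ /=.
case/set0Pn: mincyc_neq0 => v vC.
(* A leaf w of the forest C - v has degree at most 2 in C, and C - w is again a forest; this bounds
   [darts C] from above. *)
have [w] := acyc_leaf (mincyc_D1 vC) (mincyc_D1_neq0 v).
rewrite inE => /andP[wv wC] dw.
have := acyc_darts (mincyc_D1 wC) (mincyc_D1_neq0 w).
rewrite (darts_D1 wC) (cardsD1 w C) wC; have : deg w C <= 2.
  by rewrite -(setD1K vC) degU1 ?setD11 //; case: (adj w v); nlia.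
nlia.
Qed.

Lemma mincyc_deg v : v \in C -> deg v C = 2.
Proof.
move=> vC; have := mincyc_darts; rewrite {1}/darts /arcs (big_setD1 v) //=.
have : \sum_(x in C :\ v) 2 <= \sum_(x in C :\ v) deg x C.
  by apply: leq_sum => x; rewrite inE => /andP[_]; apply: mincyc_deg_le.
rewrite sum_nat_const; have := mincyc_deg_le vC.
by rewrite (cardsD1 v C) vC; nlia.
Qed.

End MinCyc.
End Counting.

(** * Trees, connectivity and saturation *)

Section Forests.
Variable G : sgraph.
Implicit Types (A B C D E F K U V W : {set G}) (u v w x y z : G).

(* Among acyclic sets the tight ones are the trees. *)
Definition tight A := 2 * #|A| <= darts A + 2.

(** Connectivity in cut form, so that no paths are needed; the empty set counts as connected. *)
Definition conn A :=
  forall U, U \subset A -> U != set0 -> arcs U (A :\: U) = 0 -> U = A.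

Definition no_two_cyc V :=
  forall A B, A \subset V -> B \subset V -> [disjoint A & B] -> cyc A -> ~~ cyc B.

Lemma acyc_U1 v A : ~~ cyc A -> deg v A <= 1 -> ~~ cyc (v |: A).
Proof.
move=> acA dv; apply/negP=> /mincyc_exists[C sC mC].
case: (boolP (v \in C)) => vC.
  have := mincyc_deg mC vC; rewrite -degD1; have : deg v (C :\ v) <= deg v A.
    by apply: degS; set_auto.
  nlia.
by move/negP: acA; apply; apply: cycS (mincyc_cyc mC); set_auto.
Qed.

Lemma acyc_U A B : ~~ cyc A -> ~~ cyc B -> arcs A B = 0 -> ~~ cyc (A :|: B).
Proof.
move=> acA acB AB0; apply/negP=> /mincyc_exists[C sC mC].
have sCA : C :&: A \subset C by apply: subsetIl.
have a0 : arcs (C :&: A) (C :\: (C :&: A)) <= arcs A B by apply: arcsS; set_auto.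
have := mincyc_darts mC; rewrite (dartsD sCA) (card_D sCA).
have acCA : ~~ cyc (C :&: A) by apply: acycS acA; set_auto.
have acCB : ~~ cyc (C :\: (C :&: A)) by apply: acycS acB; set_auto.
have := acyc_darts_le acCA; have := acyc_darts_le acCB.
case: (eqVneq (C :&: A) set0) => [CA0|CA0]; last by have := acyc_darts acCA CA0; nlia.
have CB0 : C :\: (C :&: A) != set0 by rewrite CA0 setD0 mincyc_neq0.
by have := acyc_darts acCB CB0; nlia.
Qed.

Lemma tight1 v : tight [set v].
Proof. by rewrite /tight cards1 leq_addl. Qed.

Lemma acyc_tight A : ~~ cyc A -> A != set0 -> tight A -> darts A + 2 = 2 * #|A|.
Proof. by rewrite /tight => acA A0; have := acyc_darts acA A0; nlia. Qed.

(** Take a maximal tight superset inside F: a further neighbour would bring at least one edge along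
    and keep it tight. In a forest F the result is a component. *)
Lemma grow A F : A \subset F -> A != set0 -> tight A ->
  exists W : {set G}, [/\ A \subset W, W \subset F, tight W & arcs W (F :\: W) = 0].
Proof.
move=> sAF A0 tA; pose P W := (W \subset F) && tight W.
have PA : P A by apply/andP.
have [W /maxsetP[/andP[sWF tW] maxW] sAW] := maxset_exists PA.
exists W; split=> //; apply/eqP; rewrite eqn0Ngt; apply/arcs_gt0P=> -[x [y [xW]]].
rewrite inE => /andP[yW yF] xy.
have : y |: W = W.
  apply: maxW; last exact: subsetUr.
  rewrite /P subUset sub1set yF sWF /=.
  have : 0 < deg y W by apply/deg_gt0P; exists x => //; rewrite adj_sym.
  by move: tW; rewrite /tight darts_U1 // cardsU1 yW; nlia.
by move=> eqW; case/negP: yW; rewrite -eqW setU11.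
Qed.

Lemma component v F : v \in F ->
  exists W : {set G}, [/\ v \in W, W \subset F, tight W & arcs W (F :\: W) = 0].
Proof.
move=> vF; have [|||W [vW sW tW aW]] := @grow [set v] F; rewrite ?sub1set ?tight1 //.
  by apply/set0Pn; exists v; rewrite inE.
by exists W; split=> //; rewrite -sub1set.
Qed.

(** W grows to A one vertex at a time, each new vertex having an edge to the part already reached,
    so edges minus vertices never drops. *)
Lemma conn_darts A W : conn A -> W \subset A -> W != set0 ->
  darts W + 2 * #|A| <= darts A + 2 * #|W|.
Proof.
move=> cA sWA W0.
pose P U := (U \subset A) && (darts W + 2 * #|U| <= darts U + 2 * #|W|).
have PW : P W by rewrite /P sWA /=.
have [U /maxsetP[/andP[sUA leU] maxU] sWU] := maxset_exists PW.
suff <- : U = A by [].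
apply: cA => //; first by apply: contraNneq W0 => U0; rewrite -subset0 -U0.
apply/eqP; rewrite eqn0Ngt; apply/arcs_gt0P=> -[x [y [xW]]].
rewrite inE => /andP[yU yA] xy.
have : y |: U = U.
  apply: maxU; last exact: subsetUr.
  rewrite /P subUset sub1set yA sUA /=.
  have : 0 < deg y U by apply/deg_gt0P; exists x => //; rewrite adj_sym.
  by rewrite darts_U1 // cardsU1 yU; nlia.
by move=> eqU; case/negP: yU; rewrite -eqU setU11.
Qed.

Lemma conn_tight A : conn A -> tight A.
Proof.
move=> cA; case: (set_0Vmem A) => [->|[v vA]]; first by rewrite /tight cards0.
have := conn_darts (W := [set v]) cA; rewrite sub1set vA darts1 cards1 /tight => le.
by have := le isT; rewrite -card_gt0 cards1 => /(_ isT); nlia.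
Qed.

(** Two nonempty forests without edges between them are together two edges short, whereas a tight
    set is at most one edge short. *)
Lemma tight_split A U : ~~ cyc A -> tight A -> U \subset A -> U != set0 ->
  arcs U (A :\: U) = 0 -> U = A.
Proof.
move=> acA tA sUA U0 a0; apply/eqP; rewrite eqEsubset sUA /=.
rewrite -setD_eq0; apply/negPn/negP=> D0.
have := acyc_darts (acycS sUA acA) U0.
have := acyc_darts (acycS (subsetDl A U) acA) D0.
by move: tA; rewrite /tight (dartsD sUA) a0 (card_D sUA); nlia.
Qed.

Lemma acyc_tight_deg W v F : ~~ cyc F -> W \subset F -> tight W ->
  W != set0 -> v \in F -> v \notin W -> deg v W <= 1.
Proof.
move=> acF sWF tW W0 vF vW.
have acW : ~~ cyc (v |: W) by apply: acycS acF; rewrite subUset sub1set vF.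
have := acyc_darts acW; rewrite -card_gt0 cardsU1 vW darts_U1 // => /(_ isT).
by move: tW; rewrite /tight; nlia.
Qed.

(* P says which fragments are heavy, where a fragment is joined to the rest of the forest F by at
   most one edge.  K is a minimal heavy fragment, and z is the end in K of the edge leaving K. *)
Lemma fragment_center F (P : pred {set G}) :
  ~~ cyc F -> (forall A B, A \subset B -> P A -> P B) -> ~~ P set0 -> P F ->
  exists K z, [/\ K \subset F, P K, z \in K & arcs K (F :\: K) <= 1] /\
  forall W, W \subset F :\ z -> W != set0 -> tight W ->
    exists W' : {set G},
      [/\ W \subset W', W' \subset F :\ z, arcs W' (F :\: W') <= 1 &
      W' \subset K /\ ~~ P W' \/ [disjoint W' & K]].
Proof.
move=> acF monoP P0 PF.
pose Q K := [&& K \subset F, P K & arcs K (F :\: K) <= 1].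
have QF : Q F by rewrite /Q subxx PF setDv arcsC arcs0.
case: (arg_minnP (fun K : {set G} => #|K|) QF) => K /and3P[sKF PK aK] minK.
have K0 : K != set0 by apply: contraNneq P0 => <-.
(* With z the end of the only edge leaving K, nothing leaves K - z; if no edge leaves K, any z will
   do. *)
have [z zK az] : exists2 z, z \in K & arcs (K :\ z) (F :\: K) = 0.
  case: (posnP (arcs K (F :\: K))) => [a0|/arcs_gt0P[z [y [zK yFK zy]]]].
    case/set0Pn: K0 => z zK; exists z => //.
    by apply/eqP; rewrite -leqn0 -a0 arcsS ?subsetDl.
  exists z => //; move: aK; rewrite (arcsD _ (B := [set z])) ?sub1set // arcs1.
  have : 0 < deg z (F :\: K) by apply/deg_gt0P; exists y.
  nlia.
exists K, z; split=> // W sWF W0 tW.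
have [W' [sWW' sW'F tW' aW']] := grow sWF W0 tW.
have W'0 : W' != set0.
  by apply: contraNneq W0 => W'0; rewrite -subset0 -W'0.
have zF : z \in F by apply: subsetP zK.
have zW' : z \notin W' by apply/negP=> /(subsetP sW'F); rewrite !inE eqxx.
have sW'F2 : W' \subset F by apply: subset_trans sW'F (subsetDl _ _).
have acW' : ~~ cyc W' by apply: acycS acF.
have frW' : arcs W' (F :\: W') <= 1.
  have -> : F :\: W' = z |: ((F :\ z) :\: W') by set_auto.
  rewrite arcsUr ?aW' ?addn0 ?disjoints1 ?inE ?eqxx ?andbF //.
  by rewrite arcsC arcs1; apply: (acyc_tight_deg acF).
exists W'; split=> //.
(* In F - z no edge crosses the border of K, so the tree W' lies inside K or misses it. *)
have a0 : arcs (W' :&: K) (W' :\: (W' :&: K)) = 0.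
  by apply/eqP; rewrite -leqn0 -az arcsS //; set_auto.
case: (eqVneq (W' :&: K) set0) => [WK0|WK0]; [right|left].
  by rewrite -setI_eq0 WK0.
have sW'K : W' \subset K.
  by rewrite -(tight_split acW' tW' (subsetIl _ K) WK0 a0) subsetIr.
(* A heavy W' inside K would be a smaller heavy fragment, since it misses z. *)
split=> //; apply/negP=> PW'.
have : #|K| <= #|W'| by apply: minK; rewrite /Q sW'F2 PW'.
rewrite leqNgt proper_card // properEneq sW'K andbT.
by apply: contraNneq zW' => ->.
Qed.

Lemma no_two_cycP V :
  ~ (exists A B : {set G}, [/\ A \subset V, B \subset V, [disjoint A & B], cyc A & cyc B]) ->
  no_two_cyc V.
Proof. by move=> noAB A B sA sB dAB cA; apply/negP=> cB; apply: noAB; exists A, B. Qed.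

Lemma not_no_two_cyc V : ~ no_two_cyc V ->
  exists A B : {set G}, [/\ A \subset V, B \subset V, [disjoint A & B], cyc A & cyc B].
Proof.
move=> nn; suff /existsP[A /existsP[B /and5P[]]] :
  [exists A : {set G}, exists B : {set G},
   [&& A \subset V, B \subset V, [disjoint A & B], cyc A & cyc B]] by exists A, B.
apply: contraT => /negP noAB; case: nn; apply: no_two_cycP => -[A [B [sA sB dAB cA cB]]].
by apply: noAB; apply/existsP; exists A; apply/existsP; exists B; apply/and5P.
Qed.

End Forests.

(** * Saturation in terms of edge counts *)

Section Saturation.
Variable G : sgraph.
Implicit Types (A B C D E F K U V W : {set G}) (u v w x y z : G).

(** Saturation with disjoint cycles replaced by disjoint sets satisfying [cyc]; [saturatedP] proves
    it equivalent to the definition by embedded copies. *)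
Definition sat := no_two_cyc [set: G] /\
  forall u v, u != v -> ~~ adj u v -> ~ no_two_cyc (G := add_edge u v) setT.

Lemma arcs_add u v A B : u != v -> ~~ adj u v ->
  @arcs (add_edge u v) A B =
    arcs A B + ((u \in A) && (v \in B)) + ((v \in A) && (u \in B)).
Proof.
move=> uv nuv.
have deg_add x : @deg (add_edge u v) x B =
    deg x B + ((x == u) && (v \in B)) + ((x == v) && (u \in B)).
  have delta (y : G) : \sum_(z in B) nat_of_bool (z == y) = (y \in B).
    rewrite big_mkcond /= (bigD1 y) //= eqxx big1 ?addn0; last first.
      by move=> z /negPf->; case: ifP.
    by case: (y \in B).
  have -> : @deg (add_edge u v) x B =
      \sum_(y in B) (adj x y + ((x == u) * (y == v)) + ((x == v) * (y == u))).
    rewrite /deg; apply: eq_bigr => y _ /=; rewrite /add_edge_adj.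
    case: (eqVneq x u) nuv => [->|xu] nuv; last first.
      case: (eqVneq x v) nuv => [->|xv] nuv; last by rewrite andbF orbF; nlia.
      case: (eqVneq y u) => [->|yu] /=; last by rewrite !andbF orbF; nlia.
      by rewrite adj_sym (negPf nuv) eq_sym uv.
    rewrite (negPf uv) /= orbF.
    case: (eqVneq y v) => [->|yv] /=; last by rewrite !andbF orbF; nlia.
    by rewrite (negPf nuv) uv.
  rewrite !big_split /= -!big_distrr /= !delta /deg.
  by case: (x == u); case: (x == v); case: (v \in B); case: (u \in B); nlia.
rewrite /arcs (eq_bigr _ (fun x _ => deg_add x)) !big_split /=.
have delta (y : G) (b : bool) : \sum_(x in A) nat_of_bool ((x == y) && b) = (y \in A) && b.
  rewrite big_mkcond /= (bigD1 y) //= eqxx big1 ?addn0; last first.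
    by move=> z /negPf->; case: ifP.
  by case: (y \in A).
by rewrite !delta.
Qed.

Lemma darts_add u v A : u != v -> ~~ adj u v ->
  @darts (add_edge u v) A = darts A + 2 * ((u \in A) && (v \in A)).
Proof. by move=> uv nuv; rewrite /darts arcs_add // (andbC (v \in A)); nlia. Qed.

(** A witness that uses the new edge is at most one edge short of a cycle in G, that is, tight. *)
Lemma cyc_add u v A : u != v -> ~~ adj u v -> @cyc (add_edge u v) A ->
  cyc A \/ exists D : {set G}, [/\ D \subset A, u \in D, v \in D & tight D].
Proof.
(* [add_edge u v] and [G] have convertible vertex types; the [pose] only changes the type under
   which the set is read. *)
move=> uv nuv /existsP[D' /and3P[sDA D0]]; pose D : {set G} := D'.
rewrite -[2 * _]/(2 * #|D|) (darts_add D uv nuv) => leD.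
case: (boolP ((u \in D) && (v \in D))) leD => [/andP[uD vD] leD|_ leD].
  by right; exists D; split=> //; move: leD; rewrite /tight; nlia.
by left; apply: (cycI (B := D)) => //; move: leD; nlia.
Qed.

Lemma cyc_addI u v A : u != v -> ~~ adj u v -> u \in A -> v \in A -> tight A ->
  @cyc (add_edge u v) A.
Proof.
move=> uv nuv uA vA tA; apply: (@cycI (add_edge u v) A) => //.
  by apply/set0Pn; exists u.
rewrite (darts_add A uv nuv) uA vA -[2 * _]/(2 * #|A|).
by move: tA; rewrite /tight; nlia.
Qed.

Lemma cyc_addW u v A : u != v -> ~~ adj u v -> cyc A -> @cyc (add_edge u v) A.
Proof.
move=> uv nuv /existsP[D /and3P[sDA D0 leD]].
apply: (@cycI (add_edge u v) D) => //.
by rewrite (darts_add D uv nuv) (leq_trans leD) ?leq_addr.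
Qed.

Lemma not_no_two_cyc_add u v A B : u != v -> ~~ adj u v ->
  u \in A -> v \in A -> tight A -> cyc B -> [disjoint A & B] ->
  ~ no_two_cyc (G := add_edge u v) setT.
Proof.
move=> uv nuv uA vA tA cB dAB /(_ A B (subsetT _) (subsetT _) dAB).
by rewrite (cyc_addW uv nuv cB) => /(_ (cyc_addI uv nuv uA vA tA)).
Qed.

Hypothesis satG : sat.

Lemma sat_acyc A B : [disjoint A & B] -> cyc B -> ~~ cyc A.
Proof.
by move=> dAB; apply: (proj1 satG); rewrite ?subsetT // disjoint_sym.
Qed.

(** Of the two disjoint cycles in G + uv at most one contains both u and v, and not both are cycles
    of G. So one loses the edge uv and becomes a tree through u and v, while the other is already in
    G. *)
Lemma sat_add u v : u != v -> ~~ adj u v ->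
  exists A B : {set G},
  [/\ u \in A, v \in A, tight A & ~~ cyc A] /\ (cyc B /\ [disjoint A & B]).
Proof.
move=> uv nuv; have [A0 [B0 [_ _]]] := not_no_two_cyc (proj2 satG _ _ uv nuv).
pose A : {set G} := A0; pose B : {set G} := B0.
rewrite -[A0]/A -[B0]/B => dAB cA cB.
have aux (A' B' : {set G}) : [disjoint A' & B'] ->
    @cyc (add_edge u v) B' -> (exists D : {set G}, [/\ D \subset A', u \in D, v \in D & tight D]) ->
    exists A B : {set G},
    [/\ u \in A, v \in A, tight A & ~~ cyc A] /\ (cyc B /\ [disjoint A & B]).
  move=> dAB' cB' [D [sDA uD vD tD]].
  have dDB : [disjoint D & B'] by apply: disjointWl dAB'.
  case: (cyc_add uv nuv cB') => [cB2|[E [sEB uE vE tE]]].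
    by exists D, B'; split=> //; split=> //; apply: sat_acyc cB2.
  by move: (subsetP sEB _ uE); rewrite (disjointFr dDB uD).
case: (cyc_add uv nuv cA) => [cA'|]; last exact: aux dAB cB.
case: (cyc_add uv nuv cB) => [cB'|]; last by apply: aux cA; rewrite disjoint_sym.
by have := sat_acyc dAB cB'; rewrite cA'.
Qed.

Lemma sat_split U w u : w \in U -> u \notin U -> ~~ adj w u ->
  exists A B : {set G},
  [/\ w \in A, u \in A, tight A & ~~ cyc A] /\
  [/\ cyc B, [disjoint A & B] & 0 < arcs (A :&: U) (A :\: U)].
Proof.
move=> wU uU nwu; have wu : w != u by apply: contraNneq uU => <-.
have [A [B [[wA uA tA acA] [cB dAB]]]] := sat_add wu nwu.
exists A, B; split=> //; split=> //; rewrite lt0n; apply/eqP=> a0.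
have := tight_split acA tA (subsetIl A U); rewrite setDIr setDv set0U => /(_ _ a0) eqA.
case/negP: uU; suff: u \in A :&: U by rewrite inE => /andP[].
by rewrite eqA //; apply/set0Pn; exists w; rewrite inE wA.
Qed.

(** If a side U of a cut of A0 misses x, join x to some t in U. The tree through t and x avoids a
    cycle B that contains everything outside A0, so the tree stays in A0 and crosses the cut. *)
Lemma sat_conn_at x A0 : x \in A0 ->
  (forall B, cyc B -> x \notin B -> ~: A0 \subset B) -> conn A0.
Proof.
move=> xA0 coverB.
have key U : U \subset A0 -> U != set0 -> x \notin U -> arcs U (A0 :\: U) != 0.
  move=> sU /set0Pn[t tU] xU; apply/eqP=> a0.
  have ntx : ~~ adj t x by rewrite (arcs_eq0 a0) // inE xU.
  have [A [B [[tA xA tiA acA] [cB dAB]]]] := sat_split tU xU ntx.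
  have xB : x \notin B by rewrite (disjointFr dAB xA).
  have sB := coverB B cB xB.
  have : arcs (A :&: U) (A :\: U) <= arcs U (A0 :\: U).
    apply: arcsS; first by set_auto.
    by clear tU xU; set_auto.
  by rewrite a0; nlia.
move=> U sU U0 a0; apply/eqP; rewrite eqEsubset sU /= -setD_eq0.
case: (boolP (x \in U)) => xU; last by have := key U sU U0 xU; rewrite a0.
apply/negPn/negP=> D0; have := key (A0 :\: U) (subsetDl _ _) D0.
by rewrite inE xU setDDr setDv set0U (setIidPr sU) arcsC a0 => /(_ isT).
Qed.

Lemma sat_conn : conn [set: G].
Proof.
move=> U sU U0; case/set0Pn: (U0) => x _; move: U sU U0.
by apply: (sat_conn_at (in_setT x)) => B _ _; rewrite setCT sub0set.
Qed.

(** For a non-edge xy, the cycle disjoint from the tree through x and y would avoid both. *)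
Lemma sat_fvs2_adj x y : x != y -> ~~ cyc (~: [set x; y]) -> adj x y.
Proof.
move=> xy acF; apply: contraT => nxy.
have [A [B [[xA yA _ _] [cB dAB]]]] := sat_add xy nxy.
by case/negP: acF; apply: cycS cB; set_auto.
Qed.

Lemma fvs2_cover x y B : ~~ cyc (~: [set x; y]) -> cyc B -> x \notin B -> y \in B.
Proof.
by move=> acF cB xB; apply: contraT => yB; case/negP: acF; apply: cycS cB; set_auto.
Qed.

Lemma sat_fvs2_conn x y : x != y -> ~~ cyc (~: [set x; y]) -> conn (~: [set x]).
Proof.
move=> xy acF; apply: (@sat_conn_at y) => [|B cB yB]; first by rewrite !inE eq_sym.
by rewrite setCK sub1set; apply: fvs2_cover yB; rewrite // setUC.
Qed.

End Saturation.

(** * Two vertices meeting all cycles *)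

Section TwoVertexCovers.
Variable G : sgraph.
Implicit Types (A B C D E F K R S U V W : {set G}) (p q s t u v w x y z : G).

Lemma no_two_acyc A B : no_two_cyc [set: G] -> [disjoint A & B] -> cyc B -> ~~ cyc A.
Proof. by move=> n2 dAB; apply: n2; rewrite ?subsetT // disjoint_sym. Qed.

Lemma cyc_apex v A : v \notin A -> ~~ cyc A -> cyc (v |: A) ->
  exists W : {set G}, [/\ W \subset A, W != set0, tight W & cyc (v |: W)].
Proof.
move=> vA acA /mincyc_exists[C sC mC].
have vC : v \in C.
  by apply: contraT => vC; case/negP: acA; apply: cycS (mincyc_cyc mC); set_auto.
exists (C :\ v); split; first by set_auto.
- exact: mincyc_D1_neq0.
- have := mincyc_darts mC; rewrite (darts_D1 vC) (mincyc_deg mC vC).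
  by rewrite (cardsD1 v C) vC /tight; nlia.
- by rewrite setD1K // mincyc_cyc.
Qed.

Lemma disjoint_U1 F s t A B : s \notin F -> t \notin F -> s != t ->
  A \subset F -> B \subset F -> [disjoint A & B] -> [disjoint s |: A & t |: B].
Proof. by move=> *; set_auto. Qed.

(** The numerical hypotheses say that G - y and G - x have more edges than vertices. Here a part K
    of F is heavy if x closes a cycle with it, and z is the centre given by [fragment_center]. *)
Lemma fvs2_sink x y : no_two_cyc [set: G] -> x != y -> ~~ cyc (~: [set x; y]) ->
  2 * #|~: [set x; y]| + 4 <= darts (~: [set y]) ->
  2 * #|~: [set x; y]| + 4 <= darts (~: [set x]) ->
  exists z, [/\ x != z, y != z, ~~ cyc (~: [set x; z]) & ~~ cyc (~: [set y; z])].
Proof.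
set F := ~: [set x; y] => n2 xy acF.
have xF : x \notin F by rewrite !inE eqxx.
have yF : y \notin F by rewrite !inE eqxx orbT.
have -> : ~: [set y] = x |: F by rewrite /F; set_auto.
have -> : ~: [set x] = y |: F by rewrite /F; set_auto.
move=> dxF dyF.
pose P K := cyc (x |: K).
have monoP A B : A \subset B -> P A -> P B by move=> sAB; apply: cycS; apply: setUS.
have P0 : ~~ P set0 by rewrite /P setU0 acyc1.
have PF : P F.
  apply: (cycI (B := x |: F)) => //; first by apply/set0Pn; exists x; rewrite setU11.
  by rewrite cardsU1 xF (leq_trans _ dxF) //; nlia.
have [K [z [[sKF PK zK aK] treeW]]] := fragment_center acF monoP P0 PF.
have zF : z \in F by apply: subsetP zK.
have acyc_star s A : s \notin F -> A \subset F -> ~~ cyc (s |: A) ->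
    darts A + 2 * deg s A <= 2 * #|A|.
  move=> sF sA acA; have sA' : s \notin A by apply: contra sF; apply: subsetP.
  have := acyc_darts acA; rewrite -card_gt0 cardsU1 sA' darts_U1 //.
  by move=> /(_ isT); nlia.
(* Each side contributes at most as many edges as it has vertices, counting those to s, and one edge
   joins the sides: in total at most |F| + 1 edges on |F| + 1 vertices. *)
have split_le s A : s \notin F -> A \subset F -> arcs A (F :\: A) <= 1 ->
    ~~ cyc (s |: A) -> ~~ cyc (s |: (F :\: A)) -> darts (s |: F) <= 2 * #|F| + 2.
  move=> sF sA aA acA acFA.
  have := acyc_star _ _ sF sA acA; have := acyc_star _ _ sF (subsetDl F A) acFA.
  by rewrite darts_U1 // (degD s sA) (dartsD sA) (card_D sA); nlia.
have disj s t A B := @disjoint_U1 F s t A B.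
have yx : y != x by rewrite eq_sym.
have zx : z != x by apply: contraTneq zF => ->.
have zy : z != y by apply: contraTneq zF => ->.
exists z; split; try by rewrite eq_sym.
(* Let y close a cycle with a part W' of F - z. Off K, it is disjoint from the cycle of x with K.
   Inside K, neither W' nor F - W' closes a cycle with x, contradicting the excess of G - y. *)
- have -> : ~: [set x; z] = y |: (F :\ z) by rewrite /F; set_auto.
  apply/negP=> /cyc_apex[||W [sW W0 tW cW]].
  + by rewrite inE negb_and yF orbT.
  + by apply: acycS acF; apply: subsetDl.
  have [W' [sWW' sW'F aW' cases]] := treeW W sW W0 tW.
  have sW'F' : W' \subset F by apply: subset_trans sW'F (subsetDl _ _).
  have cW' : cyc (y |: W') by apply: cycS cW; apply: setUS.
  case: cases => [[sW'K nPW']|dW'K]; last first.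
    by have := no_two_acyc n2 (disj _ _ _ _ yF xF yx sW'F' sKF dW'K) PK; rewrite cW'.
  have acFW' : ~~ cyc (x |: (F :\: W')).
    apply: no_two_acyc cW' => //; apply: disj => //; first exact: subsetDl.
    by set_auto.
  by have := split_le x W' xF sW'F' aW' nPW' acFW'; nlia.
(* A part W' with which x closes a cycle must lie off K. Then neither K nor F - K closes a cycle
   with y, contradicting the excess of G - x. *)
- have -> : ~: [set y; z] = x |: (F :\ z) by rewrite /F; set_auto.
  apply/negP=> /cyc_apex[||W [sW W0 tW cW]].
  + by rewrite inE negb_and xF orbT.
  + by apply: acycS acF; apply: subsetDl.
  have [W' [sWW' sW'F aW' cases]] := treeW W sW W0 tW.
  have sW'F' : W' \subset F by apply: subset_trans sW'F (subsetDl _ _).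
  have cW' : cyc (x |: W') by apply: cycS cW; apply: setUS.
  case: cases => [[sW'K]|dW'K]; first by rewrite /P cW'.
  have cFK : cyc (x |: (F :\: K)) by apply: cycS cW'; apply: setUS; set_auto.
  have dKF : [disjoint K & F :\: K] by set_auto.
  have acK : ~~ cyc (y |: K).
    by apply: no_two_acyc cFK => //; apply: disj => //; apply: subsetDl.
  have acFK : ~~ cyc (y |: (F :\: K)).
    apply: no_two_acyc PK => //; apply: disj => //; first exact: subsetDl.
    by rewrite disjoint_sym.
  by have := split_le y K yF sKF aK acK acFK; nlia.
Qed.

Section Triple.
Variables x y z : G.
Hypotheses (satG : sat G) (xy : x != y) (xz : x != z) (yz : y != z).
Hypotheses (acxy : ~~ cyc (~: [set x; y])) (acxz : ~~ cyc (~: [set x; z]))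
  (acyz : ~~ cyc (~: [set y; z])).
Let F := ~: [set x; y; z].

(** A cycle avoiding x contains y and z, so F + x is connected by [sat_conn_at]; it is also a
    forest, hence a tree with |F| edges. *)
Lemma triple_deg : darts F + 2 * deg x F = 2 * #|F|.
Proof.
have cF : conn (x |: F).
  apply: (sat_conn_at satG (setU11 x F)) => B cB xB.
  have yB := fvs2_cover acxy cB xB; have zB := fvs2_cover acxz cB xB.
  by rewrite /F; set_auto.
have xF : x \notin F by rewrite !inE eqxx.
have acF : ~~ cyc (x |: F) by apply: acycS acyz; rewrite /F; set_auto.
have := acyc_tight acF _ (conn_tight cF).
by rewrite -card_gt0 cardsU1 xF darts_U1 // => /(_ isT); nlia.
Qed.
End Triple.

(** Call a part of A heavy if it sends at least two edges to S. Two disjoint heavy parts would need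
    four edges, so every part off the minimal fragment is light. *)
Lemma branch_center A S : ~~ cyc A -> tight A -> A != set0 -> [disjoint A & S] ->
  arcs A S <= 3 ->
  exists2 p, p \in A & forall W, W \subset A :\ p -> W != set0 -> tight W -> arcs W S <= 1.
Proof.
move=> acA tA A0 dAS a3; pose P K := 1 < arcs K S.
case: (boolP (P A)) => PA; last first.
  case/set0Pn: A0 => p pA; exists p => // W sW _ _; move: PA; rewrite -leqNgt.
  by apply: leq_trans; apply: arcsS => //; apply: subset_trans sW (subsetDl _ _).
have monoP B C : B \subset C -> P B -> P C.
  by move=> sBC /leq_trans; apply; apply: arcsS.
have P0 : ~~ P set0 by rewrite /P arcs0.
have [K [p [[sKA PK pK _] treeW]]] := fragment_center acA monoP P0 PA.
exists p; first exact: subsetP pK.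
move=> W sW W0 tW; have [W' [sWW' sW'A _ cases]] := treeW W sW W0 tW.
have leW : arcs W S <= arcs W' S by apply: arcsS.
case: cases => [[_]|dW'K]; first by rewrite /P -leqNgt; apply: leq_trans.
have : arcs (W' :|: K) S <= arcs A S.
  by apply: arcsS => //; rewrite subUset sKA (subset_trans sW'A (subsetDl _ _)).
rewrite arcsU //; move: PK; rewrite /P; nlia.
Qed.

(** Every component of B is a tree with at most one edge to S, which makes up for the edge that the
    tree lacks. *)
Lemma branch_bound A S p : ~~ cyc A ->
  (forall W, W \subset A :\ p -> W != set0 -> tight W -> arcs W S <= 1) ->
  forall B, B \subset A :\ p -> darts B + 2 * arcs B S <= 2 * #|B|.
Proof.
move=> acA branch B; move: {2}#|B|.+1 (ltnSn #|B|) => n.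
elim: n B => // n IHn B ltB sB.
case: (set_0Vmem B) => [->|[v vB]]; first by rewrite darts0 arcs0.
have [W [vW sWB tW a0]] := component vB.
have W0 : W != set0 by apply/set0Pn; exists v.
have := branch W (subset_trans sWB sB) W0 tW.
have acW : ~~ cyc W.
  by apply: acycS acA; apply: subset_trans sWB (subset_trans sB (subsetDl _ _)).
have := acyc_tight acW W0 tW.
have : darts (B :\: W) + 2 * arcs (B :\: W) S <= 2 * #|B :\: W|.
  apply: IHn; last by apply: subset_trans sB; apply: subsetDl.
  by move: ltB; rewrite (card_D sWB); have := W0; rewrite -card_gt0; nlia.
by rewrite (dartsD sWB) a0 (arcsD S sWB) (card_D sWB); nlia.
Qed.

End TwoVertexCovers.

(** * Three vertices any two of which meet all cycles *)

Section TripleCovers.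
Variable G : sgraph.
Hypothesis satG : sat G.
Implicit Types (A B C D E F K Q R S U V W : {set G}) (p q s t u v w x y z : G).

Lemma deg_all v A : (forall u, u \in A -> adj v u) -> deg v A = #|A|.
Proof.
move=> vA; rewrite degE; apply: eq_card => u; rewrite inE andb_idr //; exact: vA.
Qed.

Lemma card_acyc2 A : #|A| <= 2 -> ~~ cyc A.
Proof.
move=> A2; apply/negP=> /mincyc_exists[C sC mC].
by have := mincyc_card mC; have := subset_leq_card sC; nlia.
Qed.

Lemma cardT_C1 x : #|G| = #|~: [set x]| + 1.
Proof. by rewrite -cardsT (card_D (subsetT [set x])) cards1 setTD addnC. Qed.

Lemma dartsT_C1 x : darts [set: G] = darts (~: [set x]) + 2 * deg x (~: [set x]).
Proof.
rewrite (darts_D1 (in_setT x)) setTD -degD1; congr (_ + 2 * deg _ _).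
by rewrite setTD.
Qed.

Section Triple.
Variables x y z : G.
Hypotheses (xy : x != y) (xz : x != z) (yz : y != z).
Hypotheses (acxy : ~~ cyc (~: [set x; y])) (acxz : ~~ cyc (~: [set x; z]))
  (acyz : ~~ cyc (~: [set y; z])).
Let S := [set x; y; z].
Let F := ~: S.

(** Adding any one of x, y, z to F gives a tree, so each of the three degrees equals the number k of
    components of F. *)
Lemma triple_degs : [/\ darts F + 2 * deg x F = 2 * #|F|, deg y F = deg x F & deg z F = deg x F].
Proof.
have dx := triple_deg satG xy xz acxy acxz acyz.
have yx : y != x by rewrite eq_sym.
have zx : z != x by rewrite eq_sym.
have zy : z != y by rewrite eq_sym.
have acyx : ~~ cyc (~: [set y; x]) by rewrite setUC.
have aczx : ~~ cyc (~: [set z; x]) by rewrite setUC.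
have aczy : ~~ cyc (~: [set z; y]) by rewrite setUC.
have := triple_deg satG yx yz acyx acyz acxz; have := triple_deg satG zx zy aczx aczy acxy.
have -> : ~: [set y; x; z] = F by rewrite /F /S; set_auto.
have -> : ~: [set z; x; y] = F by rewrite /F /S; set_auto.
by move: dx; rewrite -/S -/F; split; nlia.
Qed.

Lemma triple_card : #|G| = #|F| + 3.
Proof.
rewrite -(cardsC S) -/F addnC; congr (_ + _).
by rewrite /S -setUA cardsU1 !inE cards2 negb_or xy xz yz.
Qed.

Lemma triple_darts : darts [set: G] = 2 * #|G| + 4 * deg x F.
Proof.
have [dx dy dz] := triple_degs; rewrite triple_card.
have axy := sat_fvs2_adj satG xy acxy; have axz := sat_fvs2_adj satG xz acxz.
have ayz := sat_fvs2_adj satG yz acyz.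
have -> : [set: G] = x |: (y |: (z |: F)) by rewrite /F /S; set_auto.
have zF : z \notin F by rewrite /F ?/S !inE eqxx ?orbT.
have yF : y \notin F by rewrite /F ?/S !inE eqxx ?orbT.
have xF : x \notin F by rewrite /F ?/S !inE eqxx.
have yzF : y \notin z |: F by rewrite in_setU1 negb_or yz.
have xzF : x \notin z |: F by rewrite in_setU1 negb_or xz.
have xyzF : x \notin y |: (z |: F) by rewrite !in_setU1 !negb_or xy xz.
rewrite !darts_U1 // !degU1 // axy axz ayz; nlia.
Qed.

(** Join the centres p and q of the two trees T and U. The resulting tree A needs some s in S to get
    from T to U, so the disjoint cycle C avoids p and q and has at most two vertices in S. By
    [branch_bound] its parts in T and U, with their edges to S, have at most as many edges as
    vertices, and its part in S has fewer: too few edges for a cycle. *)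
Lemma triple_deg_neq2 : deg x F != 2.
Proof.
apply/eqP=> d2; have [] := triple_degs; rewrite d2 => dF dy dz.
have acF : ~~ cyc F by apply: acycS acxy; rewrite /F /S; set_auto.
have [v vF] : exists v, v \in F by apply/set0Pn; rewrite -card_gt0; nlia.
have [T [vT sTF tT a0]] := component vF; set U := F :\: T in a0.
have T0 : T != set0 by apply/set0Pn; exists v.
have acT : ~~ cyc T by apply: acycS acF.
have sUF : U \subset F by apply: subsetDl.
have acU : ~~ cyc U by apply: acycS acF.
have dT := acyc_tight acT T0 tT.
have dU : darts U + 2 = 2 * #|U|.
  by have := dartsD sTF; rewrite -/U a0; have := card_D sTF; rewrite -/U; nlia.
have U0 : U != set0 by rewrite -card_gt0; nlia.
have tU : tight U by rewrite /tight; nlia.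
have FS : [disjoint F & S] by rewrite /F -setI_eq0 setIC setICr.
have xF : x \notin F by rewrite /F ?/S !inE eqxx.
have yF : y \notin F by rewrite /F ?/S !inE eqxx ?orbT.
have zF : z \notin F by rewrite /F ?/S !inE eqxx ?orbT.
have acxF : ~~ cyc (x |: F) by apply: acycS acyz; rewrite /F /S; set_auto.
have acyF : ~~ cyc (y |: F) by apply: acycS acxz; rewrite /F /S; set_auto.
have aczF : ~~ cyc (z |: F) by apply: acycS acxy; rewrite /F /S; set_auto.
have arcsS_le W : W \subset F -> W != set0 -> tight W -> arcs W S <= 3.
  move=> sWF W0 tW; rewrite arcsC /S -setUA arcs1U ?inE ?negb_or ?xy //.
  rewrite arcs1U ?inE // arcs1.
  have key s : s \notin F -> ~~ cyc (s |: F) -> deg s W <= 1.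
    move=> sF acs; apply: (acyc_tight_deg acs) => //; rewrite ?setU11 //.
      by apply: subset_trans sWF (subsetUr _ _).
    by apply: contra sF; apply: subsetP.
  by have := key _ xF acxF; have := key _ yF acyF; have := key _ zF aczF; nlia.
have [p pT branchp] := branch_center acT tT T0 (disjointWl sTF FS) (arcsS_le T sTF T0 tT).
have [q qU branchq] := branch_center acU tU U0 (disjointWl sUF FS) (arcsS_le U sUF U0 tU).
have bp := branch_bound acT branchp; have bq := branch_bound acU branchq.
have npq : ~~ adj p q by rewrite (arcs_eq0 a0).
have qT : q \notin T by move: qU; rewrite inE => /andP[].
have pq : p != q by apply: contraNneq qT => <-.
have [A [B [[pA qA tA acA] [cB dAB]]]] := sat_add satG pq npq.
have [s sS sA] : exists2 s, s \in S & s \in A.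
  apply/exists_inP; apply: contraT => /exists_inPn noS.
  have sAF : A \subset F.
    by apply/subsetP=> u uA; rewrite inE; apply: contraL uA; apply: noS.
  have a00 : arcs (A :&: T) (A :\: (A :&: T)) = 0.
    apply/eqP; rewrite -leqn0 -a0; apply: arcsS; first exact: subsetIr.
    by rewrite /U; clear -sAF; set_auto.
  have AT0 : A :&: T != set0 by apply/set0Pn; exists p; rewrite inE pA.
  have := tight_split acA tA (subsetIl A T) AT0 a00 => eqA.
  by move: qA; rewrite -eqA inE (negPf qT) andbF.
have [C sCB mC] := mincyc_exists cB.
have outC u : u \in A -> u \notin C.
  by move=> uA; apply: contraTN uA => /(subsetP sCB) uB; rewrite (disjointFl dAB uB).
have pC := outC _ pA; have qC := outC _ qA; have sC := outC _ sA.
have := mincyc_darts mC; rewrite (dartsD (subsetIl C S)) (card_D (subsetIl C S)).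
set C0 := C :&: S; set D := C :\: C0.
have sDF : D \subset F by rewrite /D /C0 /F; clear; set_auto.
rewrite (dartsD (subsetIl D T)) (card_D (subsetIl D T)) (arcsC C0) (arcsD C0 (subsetIl D T)).
set C1 := D :&: T; set C2 := D :\: C1.
have DC u : u \in D -> u \in C by apply/subsetP; apply: subsetDl.
have sC1 : C1 \subset T :\ p.
  apply/subsetP=> u; rewrite {1}/C1 in_setI => /andP[uD uT]; rewrite in_setD1 uT andbT.
  by apply: contraNneq pC => <-; apply: DC.
have sC2 : C2 \subset U :\ q.
  apply/subsetP=> u; rewrite {1}/C2 in_setD => /andP[uC1 uD].
  rewrite in_setD1 in_setD (subsetP sDF u uD) andbT; apply/andP; split.
    by apply: contraNneq qC => <-; apply: DC.
  by apply: contra uC1 => uT; rewrite in_setI uD.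
have a12 : arcs C1 C2 = 0.
  apply/eqP; rewrite -leqn0 -a0; apply: arcsS.
    by apply: subset_trans sC1 (subsetDl _ _).
  by apply: subset_trans sC2 (subsetDl _ _).
have C00 : C0 != set0.
  apply/negP=> /eqP C00; case/negP: acF; apply: cycS (mincyc_cyc mC).
  by rewrite -(setD0 C) -C00.
have S2 : #|S :\ s| <= 2.
  have : #|S| <= 3 by rewrite /S -setUA cardsU1 cards2; case: (_ \notin _); case: (_ != _).
  by rewrite (cardsD1 s S) sS; nlia.
have C02 : #|C0| <= 2.
  apply: leq_trans S2; apply: subset_leq_card; apply/subsetP=> u.
  by rewrite !inE => /andP[uC ->]; rewrite andbT; apply: contraNneq sC => <-.
have := acyc_darts (card_acyc2 C02) C00.
have := bp C1 sC1; have := bq C2 sC2; rewrite a12.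
have : arcs C1 C0 <= arcs C1 S by apply: arcsS; rewrite ?subsetIr.
have : arcs C2 C0 <= arcs C2 S by apply: arcsS; rewrite ?subsetIr.
nlia.
Qed.

End Triple.

(** * Deleting one vertex leaves a single cycle *)

Section Unicyclic.
Variables x y : G.
Hypotheses (xy : x != y) (acF : ~~ cyc (~: [set x; y])).
Let H := ~: [set x].
Hypotheses (cH : cyc H) (dH : darts H <= 2 * #|H|).

(** Another cycle D meets R by saturation. If R is not contained in D, then their intersection is a
    forest, so by supermodularity the union has more edges than vertices, which [conn_darts]
    excludes in H. *)
Lemma unicyclic_rim : exists R : {set G},
  [/\ mincyc R, R \subset H, forall B, B \subset H -> cyc B -> R \subset B & darts H = 2 * #|H|].
Proof.
have connH := sat_fvs2_conn satG xy acF.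
have [R sRH mR] := mincyc_exists cH; exists R; split=> //; last first.
  by have := conn_darts connH sRH (mincyc_neq0 mR); rewrite (mincyc_darts mR); nlia.
move=> B sBH /existsP[D /and3P[sDB D0 dD]]; apply: contraT => nRB.
have RD0 : R :&: D != set0.
  apply/negP=> /eqP RD0; have cD : cyc D by apply: cycI dD.
  have := sat_acyc satG _ cD (A := R); rewrite -setI_eq0 RD0 eqxx => /(_ isT).
  by rewrite mincyc_cyc.
have acRD : ~~ cyc (R :&: D).
  apply: (mincyc_proper mR); rewrite properE subsetIl /=; apply: contra nRB => sR.
  by apply: subset_trans sR (subset_trans (subsetIr _ _) sDB).
have := acyc_darts acRD RD0; have := darts_supermod R D; have := cardsUI R D.
have RD : R :|: D != set0.
  by apply: contraNneq D0 => RD; rewrite -subset0 -RD subsetUr.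
have := conn_darts connH (_ : R :|: D \subset H) RD.
rewrite subUset sRH (subset_trans sDB sBH) => /(_ isT).
by rewrite (mincyc_darts mR); nlia.
Qed.

Variable R : {set G}.
Hypotheses (mR : mincyc R) (sRH : R \subset H).
Hypothesis minR : forall B, B \subset H -> cyc B -> R \subset B.

Lemma rim_notin B : cyc B -> x \notin B -> R \subset B.
Proof.
move=> cB xB; apply: minR => //; apply/subsetP=> u uB.
by rewrite !inE; apply: contraNneq xB => <-.
Qed.

(** For a non-edge xt, the cycle disjoint from the tree through x and t would avoid x, hence contain
    R and with it t. *)
Lemma rim_adj t : t \in R -> adj x t.
Proof.
move=> tR; have tH := subsetP sRH t tR; apply: contraT => nxt.
have xt : x != t by apply: contraTneq tH => <-; rewrite !inE eqxx.
have [A [B [[xA tA _ _] [cB dAB]]]] := sat_add satG xt nxt.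
have xB : x \notin B by rewrite (disjointFr dAB xA).
by have := subsetP (rim_notin cB xB) t tR; rewrite (disjointFr dAB tA).
Qed.

Lemma rim_compl_conn : conn (~: R).
Proof.
apply: (@sat_conn_at G satG x) => [|B cB xB]; last by rewrite setCK; apply: rim_notin.
by rewrite inE; apply/negP=> /(subsetP sRH); rewrite !inE eqxx.
Qed.

(** Let O = H - R. Since O + x is connected, |O| is at most e(O) + deg x O; since H has |H| edges
    and R has |R|, |O| = e(O) + [arcs R O]. Comparing gives the second claim. *)
Lemma rim_count :
  [/\ deg x H = #|R| + deg x (H :\: R), arcs R (H :\: R) <= deg x (H :\: R) &
      H :\: R != set0 -> 0 < deg x (H :\: R)].
Proof.
have xO : x \notin H :\: R by rewrite !inE eqxx andbF.
have [R' [_ _ _ dHE]] := unicyclic_rim.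
have cO : ~: R = x |: (H :\: R).
  apply/setP=> u; rewrite !inE; case: eqVneq => [->|_]; last by rewrite andbT.
  by apply/negP=> /(subsetP sRH); rewrite !inE eqxx.
have := conn_tight rim_compl_conn; rewrite /tight cO cardsU1 xO darts_U1 // => tO.
have acO : ~~ cyc (H :\: R).
  by apply: (sat_acyc satG _ (mincyc_cyc mR)); set_auto.
have dRO := dartsD sRH; have cRO := card_D sRH; have dR := mincyc_darts mR.
split.
- by rewrite (degD x sRH) (deg_all rim_adj).
- by nlia.
- by move=> O0; have := acyc_darts acO O0; nlia.
Qed.

End Unicyclic.

(** A nonempty forest F excludes k = 0. For k = 1, G - x has as many edges as vertices and x has
    degree 3, so by [rim_count] G - x is just a triangle and n = 4. *)
Lemma triple_deg_ge3 x y z : x != y -> x != z -> y != z ->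
  ~~ cyc (~: [set x; y]) -> ~~ cyc (~: [set x; z]) -> ~~ cyc (~: [set y; z]) ->
  4 < #|G| -> 3 <= deg x (~: [set x; y; z]).
Proof.
move=> xy xz yz acxy acxz acyz; rewrite (triple_card xy xz yz) => n5.
have [dF dy dz] := triple_degs xy xz yz acxy acxz acyz.
have := triple_deg_neq2 xy xz yz acxy acxz acyz.
set F := ~: _ in n5 dF dy dz * => d2.
have acF : ~~ cyc F by apply: acycS acxy; rewrite /F; set_auto.
have F0 : F != set0 by rewrite -card_gt0; nlia.
have d0 := acyc_darts acF F0.
suff d1 : deg x F != 1 by move: d2 d1; lia.
apply/eqP=> d1.
have ayz := sat_fvs2_adj satG yz acyz.
have axy := sat_fvs2_adj satG xy acxy; have axz := sat_fvs2_adj satG xz acxz.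
have zF : z \notin F by rewrite /F ?/S !inE eqxx ?orbT.
have yF : y \notin F by rewrite /F ?/S !inE eqxx ?orbT.
have yzF : y \notin z |: F by rewrite in_setU1 negb_or yz.
have HE : ~: [set x] = y |: (z |: F) by rewrite /F; set_auto.
have cHE : #|~: [set x]| = #|F| + 2 by rewrite HE !cardsU1 yzF zF; nlia.
have dHE : darts (~: [set x]) = 2 * #|~: [set x]|.
  by rewrite cHE HE !darts_U1 // degU1 // ayz; nlia.
have cH : cyc (~: [set x]).
  apply: (cycI (B := ~: [set x])) => //; last by rewrite dHE.
  by apply/set0Pn; exists y; rewrite !inE eq_sym.
have dH : darts (~: [set x]) <= 2 * #|~: [set x]| by rewrite dHE.
have [R [mR sR minR _]] := unicyclic_rim xy acxy cH dH.
have [dx _ O0] := rim_count xy acxy cH dH mR sR minR.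
have R3 := mincyc_card mR.
have dx3 : deg x (~: [set x]) = 3 by rewrite HE !degU1 // axy axz d1.
have : ~: [set x] :\: R = set0.
  by apply/eqP; apply: contraT => /O0; nlia.
by move/(congr1 (fun A : {set G} => #|A|)); rewrite cards0; have := card_D sR; nlia.
Qed.

(** Suppose deg x is at most 5. If H = R, then n = deg x + 1 = 6. Otherwise R has at most 4
    vertices, and two of them, t1 and t2, form with x a triple any two of which meet all cycles;
    then the edge number of such triples is too large. *)
Lemma unicyclic_edges x y : x != y -> ~~ cyc (~: [set x; y]) ->
  cyc (~: [set x]) -> darts (~: [set x]) <= 2 * #|~: [set x]| -> 5 < #|G| ->
  darts [set: G] = 2 * #|~: [set x]| + 2 * deg x (~: [set x]) /\
  (5 < deg x (~: [set x]) \/ #|G| = 6 /\ deg x (~: [set x]) = 5).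
Proof.
move=> xy acF cH dH n6; set H := ~: [set x] in cH dH *.
have [R [mR sR minR dHE]] := unicyclic_rim xy acF cH dH.
have dT : darts [set: G] = 2 * #|H| + 2 * deg x H by rewrite (dartsT_C1 x) dHE.
split=> //; rewrite ltnNge; case: (leqP (deg x H) 5) => d5; [right|by left].
have [dx aRO O0] := rim_count xy acF cH dH mR sR minR; rewrite -/H in dx aRO O0.
have cn := cardT_C1 x; have cRO := card_D sR; rewrite -/H in cn cRO.
set O := H :\: R in dx aRO O0 cRO.
have [O0'|O0'] := eqVneq O set0; first by rewrite O0' cards0 deg0 in cRO dx *; nlia.
have dO := O0 O0'; have R3 := mincyc_card mR.
exfalso.
have xR : x \notin R by apply/negP=> /(subsetP sR); rewrite !inE eqxx.
have [t1 [t2 [t1R t2R t12 [dR0 pend]]]] : exists t1 t2 : G, [/\ t1 \in R, t2 \in R, t1 != t2 &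
    darts (R :\: [set t1; t2]) = 0 /\ forall t, t \in R :\: [set t1; t2] -> deg t O = 0].
  have R5 : #|R| <= 4 by nlia.
  have [R4|R4] := eqVneq #|R| 4; last first.
    have R3' : #|R| = 3 by move: R4; lia.
    (* For a triangle R at most two edges leave R towards O, so some t3 has none; t1 and t2 are the
       other two vertices. *)
    have [t3 t3R dt3] : exists2 t, t \in R & deg t O = 0.
      have [/exists_inP[t tR /eqP]|] := boolP [exists t in R, deg t O == 0]; first by exists t.
      move=> /exists_inPn pos; have : \sum_(t in R) 1 <= arcs R O.
        by apply: leq_sum => t /pos; rewrite lt0n.
      by rewrite sum1_card; nlia.
    have := mincyc_deg_le mR t3R => /deg_gt1P[t1 [t2 [t1R t2R t12 a1 a2]]].
    exists t1, t2; split=> //.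
    have -> : R :\: [set t1; t2] = [set t3].
      apply/eqP; rewrite eq_sym eqEcard sub1set !inE t3R negb_or !adj_neq //= cards1.
      have : [set t1; t2] \subset R by rewrite subUset !sub1set t1R.
      by move/card_D; rewrite cards2 t12; nlia.
    by rewrite darts1; split=> // t /set1P->.
  (* For |R| = 4 at most one edge leaves R towards O: t1 is its end in R, or arbitrary if there is
     none, and t2 is the vertex of R opposite t1. *)
  have aRO1 : arcs R O <= 1 by nlia.
  have [t1 t1R pend] : exists2 t1, t1 \in R & forall t, t \in R -> t != t1 -> deg t O = 0.
    have [/eqP a0|] := posnP (arcs R O).
      case/set0Pn: (mincyc_neq0 mR) => t1 t1R; exists t1 => // t tR _.
      by have := deg_arcs O tR; rewrite (eqP a0); nlia.
    case/arcs_gt0P=> t1 [o [t1R oO t1o]]; exists t1 => // t tR tt1.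
    have : arcs [set t1; t] O <= arcs R O by apply: arcsS; rewrite // subUset !sub1set t1R.
    rewrite arcs1U ?inE 1?eq_sym // arcs1.
    have : 0 < deg t1 O by apply/deg_gt0P; exists o.
    nlia.
  have := mincyc_deg_le mR t1R => /deg_gt1P[p [q [pR qR pq t1p t1q]]].
  have t1pq : t1 \notin [set p; q] by rewrite !inE negb_or !adj_neq.
  have c3 : #|[set t1; p; q]| = 3 by rewrite -setUA cardsU1 t1pq cards2 pq.
  have s3 : [set t1; p; q] \subset R by rewrite !subUset !sub1set t1R pR qR.
  have npq : ~~ adj p q.
    apply/negP=> apq; have : ~~ cyc [set t1; p; q].
      apply: (mincyc_proper mR); rewrite properEcard s3 c3; nlia.
    move/negP; apply; apply: (cycI (B := [set t1; p; q])) => //.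
      by apply/set0Pn; exists t1; rewrite !inE eqxx.
    rewrite c3 -setUA darts_U1 // darts2 // degU1 ?inE // {1}/deg big_set1.
    by rewrite t1p t1q.
  have [t2 t2R t2s] : exists2 t2, t2 \in R & t2 \notin [set t1; p; q].
    have /card_gt0P[t2] : 0 < #|R :\: [set t1; p; q]|.
      by have := card_D s3; rewrite c3; nlia.
    by rewrite inE => /andP[]; exists t2.
  have t12 : t1 != t2 by apply: contraNneq t2s => <-; rewrite !inE eqxx.
  exists t1, t2; split=> //.
  have -> : R :\: [set t1; t2] = [set p; q].
    apply/eqP; rewrite eq_sym eqEcard; apply/andP; split.
      move: t2s t1pq; rewrite !inE !negb_or => /andP[/andP[_ t2p] t2q] /andP[t1p' t1q'].
      rewrite subUset !sub1set !inE !negb_or pR qR !andbT.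
      by rewrite (eq_sym p) (eq_sym q) t1p' (eq_sym p) t2p (eq_sym q) t1q' t2q.
    have : [set t1; t2] \subset R by rewrite subUset !sub1set t1R.
    by move/card_D; rewrite !cards2 t12 pq; nlia.
  split; first by rewrite darts_U1 ?inE // darts1 {1}/deg big_set1 (negPf npq).
  move=> t; rewrite !inE => tpq; apply: pend.
    by case/orP: tpq => /eqP->.
  by apply: contraNneq t1pq => <-; rewrite !inE.
have sH B t : cyc B -> x \notin B -> t \in R -> t \in B.
  by move=> cB xB tR; apply: (subsetP (rim_notin minR cB xB)).
have acx t : t \in R -> ~~ cyc (~: [set x; t]).
  move=> tR; apply/negP=> /sH/(_ _ tR); rewrite !inE !eqxx !orbT /=.
  by move=> /(_ isT).
(* A cycle avoiding t1 and t2 contains some other t of R, whose only possible neighbour left is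
   x. *)
have ac12 : ~~ cyc (~: [set t1; t2]).
  apply/negP=> /mincyc_exists[C sC mC].
  have acR : ~~ cyc (~: R) by apply: (sat_acyc satG _ (mincyc_cyc mR)); set_auto.
  have [t tR tC] : exists2 t, t \in R & t \in C.
    apply/exists_inP; apply: contraT => /exists_inPn noR; case/negP: acR.
    apply: cycS (mincyc_cyc mC); apply/subsetP=> u uC; rewrite inE.
    by apply: contraL uC; apply: noR.
  have tR' : t \in R :\: [set t1; t2] by rewrite inE tR andbT; have := subsetP sC t tC; rewrite inE.
  have := mincyc_deg_le mC tC; have : deg t C <= deg t (x |: (O :|: (R :\: [set t1; t2]))).
    by apply: degS; rewrite /O /H; set_auto.
  rewrite degU1 ?degU; first 1 last.
  - by rewrite /O; set_auto.
  - by rewrite !inE eqxx (negPf xR) andbF.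
  rewrite (pend t tR'); have : deg t (R :\: [set t1; t2]) <= darts (R :\: [set t1; t2]).
    exact: deg_arcs.
  by rewrite dR0; case: (adj t x); nlia.
have xt1 : x != t1 by apply: contraNneq xR => ->.
have xt2 : x != t2 by apply: contraNneq xR => ->.
have n5 : 4 < #|G| by nlia.
(* Equating 2(n - 1) + 2 deg x with 2n + 4k gives deg x = 2k + 1, which is at least 7. *)
have := triple_deg_ge3 xt1 xt2 t12 (acx _ t1R) (acx _ t2R) ac12 n5.
have := triple_darts xt1 xt2 t12 (acx _ t1R) (acx _ t2R) ac12.
by rewrite dT; nlia.
Qed.

End TripleCovers.

(** * A vertex meeting all cycles *)

(** Splits a [uniq] hypothesis into disequalities; the goal is hidden behind a local name so that
    the rewriting leaves it alone. *)
Ltac uniq_hyp H :=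
  match goal with |- ?g =>
    let P := fresh "P" in
    pose P := g; change P; move: H; rewrite /= !inE !negb_or;
    repeat match goal with
    | |- is_true (_ && _) -> _ => case/andP
    | |- is_true _ -> _ => intro
    end; unfold P; clear P
  end.
Ltac uniq_goal :=
  rewrite /= ?inE ?negb_or; repeat (apply/andP; split) => //; by rewrite // eq_sym.

Section ClosedPaths.
Variable G : sgraph.
Implicit Types (u w : G) (p : seq G).

Lemma path_darts u p : path (@adj G) u p -> uniq (u :: p) ->
  2 * size p <= darts [set z in u :: p].
Proof.
elim/last_ind: p => // p w IHp; rewrite rcons_path => /andP[pp lw].
rewrite -rcons_cons rcons_uniq => /andP[wp up]; have := IHp pp up.
have -> : [set z in rcons (u :: p) w] = w |: [set z in u :: p].
  by apply/setP=> z; rewrite in_setU1 !in_set mem_rcons in_cons.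
rewrite darts_U1 ?in_set // size_rcons.
have : 0 < deg w [set z in u :: p].
  by apply/deg_gt0P; exists (last u p); rewrite 1?adj_sym // in_set mem_last.
by nlia.
Qed.

Lemma closed_path_cyc u p w : path (@adj G) u (rcons p w) -> uniq (u :: rcons p w) ->
  p != [::] -> adj w u -> cyc [set z in u :: rcons p w].
Proof.
rewrite rcons_path => /andP[pp lw]; rewrite -rcons_cons rcons_uniq => /andP[wp up] p0 wu.
apply: (cycI (subxx _)); first by apply/set0Pn; exists u; rewrite in_set mem_rcons !in_cons eqxx orbT.
have -> : [set z in rcons (u :: p) w] = w |: [set z in u :: p].
  by apply/setP=> z; rewrite in_setU1 !in_set mem_rcons in_cons.
have cp : #|[set z in u :: p]| = (size p).+1.
  by rewrite cardsE (card_uniqP up).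
rewrite darts_U1 ?cardsU1 ?in_set // wp cp.
have : 1 < deg w [set z in u :: p].
  (* A nonempty p makes these two neighbours of w distinct. *)
  apply/deg_gt1P; exists u, (last u p).
  rewrite !in_set mem_last in_cons eqxx wu adj_sym lw; split=> //.
  case/lastP: p p0 up {pp lw wp cp} => // p v _; rewrite last_rcons /= mem_rcons inE negb_or.
  by case/andP=> /andP[].
by have := path_darts pp up; nlia.
Qed.

End ClosedPaths.

Section UniversalVertex.
Variable G : sgraph.
Hypothesis satG : sat G.
Implicit Types (A B C D W U : {set G}) (a b c d p q s t u v w x y z : G).
Variable x : G.
Let H := ~: [set x].
Hypothesis acH : ~~ cyc H.

Lemma universal_cover B : cyc B -> x \in B.
Proof.
move=> cB; apply: contraT => xB; case/negP: acH; apply: cycS cB.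
by rewrite /H; set_auto.
Qed.

Lemma universal_adj t : t != x -> adj x t.
Proof.
move=> tx; apply: contraT => nxt; have xt : x != t by rewrite eq_sym.
have [A [B [[xA _ _ _] [cB dAB]]]] := sat_add satG xt nxt.
by have := universal_cover cB; rewrite (disjointFr dAB xA).
Qed.

Lemma universal_conn : conn H.
Proof.
move=> U sU U0; case/set0Pn: (U0) => y yU; move: U sU U0 yU => U sU U0 yU.
apply: (@sat_conn_at G satG y) => // [|B cB _]; first exact: subsetP sU y yU.
by rewrite setCK sub1set; apply: universal_cover.
Qed.

Definition gap A := exists p q, [/\ p \in H, q \in H, p \notin A, q \notin A & adj p q].

(* Adding the non-edge uv closes a cycle on A, and the second cycle uses x and an edge off A. *)
Lemma universal_gap u v : u \in H -> v \in H -> u != v -> ~~ adj u v ->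
  exists A, [/\ A \subset H, tight A, u \in A, v \in A & gap A].
Proof.
move=> uH vH uv nuv; have [A [B [[uA vA tA _] [cB dAB]]]] := sat_add satG uv nuv.
have [C sCB mC] := mincyc_exists cB.
have xC : x \in C by apply: universal_cover; apply: mincyc_cyc.
have outA w : w \in C -> w \notin A by move=> /(subsetP sCB) wB; rewrite (disjointFl dAB wB).
exists A; split=> //.
  by apply/subsetP=> w wA; rewrite !inE; apply: contraTneq wA => ->; apply: outA.
have := mincyc_darts mC; rewrite (darts_D1 xC) (mincyc_deg mC xC).
have := mincyc_card mC; rewrite (cardsD1 x C) xC => c3 d3.
have /darts_gt0P[p [q []]] : 0 < darts (C :\ x) by nlia.
rewrite !in_setD1 => /andP[px pC] /andP[qx qC] pq; exists p, q.
by rewrite !inE px qx !outA.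
Qed.

Lemma tight_extend A b u : tight A -> u \in A -> adj u b -> tight (b |: A).
Proof.
move=> tA uA ub; have [bA|bA] := boolP (b \in A).
  by rewrite (setUidPr _) // sub1set.
have : 0 < deg b A by apply/deg_gt0P; exists u; rewrite // adj_sym.
by move: tA; rewrite /tight darts_U1 // cardsU1 bA; nlia.
Qed.

Lemma tight_between A b u w : A \subset H -> tight A -> b \in H -> u \in A -> w \in A ->
  u != w -> adj u b -> adj b w -> b \in A.
Proof.
move=> sA tA bH uA wA uw ub bw; apply: contraT => bA.
have A0 : A != set0 by apply/set0Pn; exists u.
have := acyc_tight_deg acH sA tA A0 bH bA.
by rewrite leqNgt => /negP[]; apply/deg_gt1P; exists u, w; rewrite adj_sym.
Qed.

(** From here n is 6 or 7. A tree A through both ends of a path of H contains the whole path, and a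
    gap leaves two vertices of H outside, so |A| is at most 4. This excludes paths on 5, then 4,
    then 3 vertices, although H is a tree on at least five vertices. *)
Hypotheses (n6 : 5 < #|G|) (n7 : #|G| <= 7).

Lemma universal_card : #|H| = #|G| - 1.
Proof. by rewrite (cardT_C1 x) addnK. Qed.

Lemma universal_nadj u (p : seq G) w : {subset u :: rcons p w <= H} ->
  path (@adj G) u (rcons p w) -> uniq (u :: rcons p w) -> p != [::] -> ~~ adj u w.
Proof.
move=> sH pp up p0; apply/negP; rewrite adj_sym => /(closed_path_cyc pp up p0) cP.
by case/negP: acH; apply: cycS cP; apply/subsetP=> z; rewrite inE; apply: sH.
Qed.

Lemma sub_all (s : seq G) : all [in H] s -> {subset s <= H}.
Proof. by move/allP. Qed.

Lemma small_gap A : gap A -> A \subset H -> #|A| <= 4.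
Proof.
case=> p [q [pH qH pA qA pq]] sA.
have : #|q |: (p |: A)| <= #|H|.
  by apply: subset_leq_card; rewrite !subUset !sub1set pH qH.
by rewrite !cardsU1 pA in_setU1 negb_or qA eq_sym (adj_neq pq) universal_card; nlia.
Qed.

Lemma path3_closed A u b w : A \subset H -> tight A -> uniq [:: u; b; w] ->
  u \in A -> w \in A -> b \in H -> adj u b -> adj b w -> b \in A.
Proof.
by move=> sA tA un uA wA bH; uniq_hyp un; apply: (tight_between sA tA bH uA wA).
Qed.

(** If neither inner vertex were in A, then A + b would be tight, and the shorter path from b to w
    would force c into A. *)
Lemma path4_closed A u b c w : A \subset H -> tight A -> uniq [:: u; b; c; w] ->
  u \in A -> w \in A -> b \in H -> c \in H -> adj u b -> adj b c -> adj c w ->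
  b \in A /\ c \in A.
Proof.
move=> sA tA un uA wA bH cH ub bc cw; uniq_hyp un.
have [bA|bA] := boolP (b \in A).
  by split=> //; apply: (path3_closed sA tA _ bA wA cH) => //; uniq_goal.
have [cA|cA] := boolP (c \in A).
  by case/negP: bA; apply: (path3_closed sA tA _ uA cA bH) => //; uniq_goal.
have sbA : b |: A \subset H by rewrite subUset sub1set bH.
have wbA : w \in b |: A by rewrite in_setU1 wA orbT.
have unb : uniq [:: b; c; w] by uniq_goal.
have := path3_closed sbA (tight_extend tA uA ub) unb (setU11 _ _) wbA cH bc cw.
by rewrite in_setU1 (negPf cA) orbF eq_sym (negPf (adj_neq bc)).
Qed.

Lemma path5_closed A u b c d w : A \subset H -> tight A -> uniq [:: u; b; c; d; w] ->
  u \in A -> w \in A -> b \in H -> c \in H -> d \in H ->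
  adj u b -> adj b c -> adj c d -> adj d w ->
  [/\ b \in A, c \in A & d \in A].
Proof.
move=> sA tA un uA wA bH cH dH ub bc cd dw; uniq_hyp un.
have unb : uniq [:: b; c; d; w] by uniq_goal.
have [bA|bA] := boolP (b \in A).
  by have [cA dA] := path4_closed sA tA unb bA wA cH dH bc cd dw.
have sbA : b |: A \subset H by rewrite subUset sub1set bH.
have wbA : w \in b |: A by rewrite in_setU1 wA orbT.
have [] := path4_closed sbA (tight_extend tA uA ub) unb (setU11 _ _) wbA cH dH bc cd dw.
rewrite in_setU1 eq_sym (negPf (adj_neq bc)) /= => cA _.
by case/negP: bA; apply: (path3_closed sA tA _ uA cA bH) => //; uniq_goal.
Qed.

Lemma no_path5 u b c d w : uniq [:: u; b; c; d; w] ->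
  {subset [:: u; b; c; d; w] <= H} ->
  adj u b -> adj b c -> adj c d -> adj d w -> False.
Proof.
move=> un sH ub bc cd dw.
have nuw : ~~ adj u w.
  by apply: (@universal_nadj u [:: b; c; d] w); rewrite //= ub bc cd dw.
have [uH bH cH dH wH] : [/\ u \in H, b \in H, c \in H, d \in H & w \in H].
  by split; apply: sH; rewrite !inE eqxx ?orbT.
have uw : u != w by uniq_hyp un.
have [A [sA tA uA wA gA]] := universal_gap uH wH uw nuw.
have [bA cA dA] := path5_closed sA tA un uA wA bH cH dH ub bc cd dw.
have : #|[set z in [:: u; b; c; d; w]]| <= #|A|.
  apply: subset_leq_card; apply/subsetP=> z; rewrite !inE.
  by case/or4P=> [|||/orP[]] /eqP->.
by rewrite cardsE (card_uniqP un) /=; have := small_gap gA sA; nlia.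
Qed.

Lemma universal_exit U : U \subset H -> U != set0 -> U != H ->
  exists v s, [/\ v \in U, s \in H, s \notin U & adj v s].
Proof.
move=> sU U0 UH; have /arcs_gt0P[v [s [vU]]] : 0 < arcs U (H :\: U).
  rewrite lt0n; apply: contraNneq UH => a0; apply/eqP.
  exact: universal_conn a0.
by rewrite in_setD => /andP[sU' sH] vs; exists v, s.
Qed.

Lemma six_cover (s : seq G) : uniq s -> size s = 6 -> {subset s <= H} -> H =i s.
Proof.
move=> us s6 sH z; have [||_ eqH] := uniq_min_size us (s2 := enum H).
- by move=> t ts; rewrite mem_enum sH.
- by rewrite -cardE universal_card s6; nlia.
by rewrite -(mem_enum H) eqH.
Qed.

(** The path and the gap edge pq exhaust the six vertices of H. By connectivity p or q has a
    neighbour on the path, and each possible attachment produces a path on five vertices. *)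
Lemma no_path4 u b c w : uniq [:: u; b; c; w] ->
  {subset [:: u; b; c; w] <= H} ->
  adj u b -> adj b c -> adj c w -> False.
Proof.
move=> un sH ub bc cw.
have nuw : ~~ adj u w.
  by apply: (@universal_nadj u [:: b; c] w); rewrite //= ub bc cw.
have [uH bH cH wH] : [/\ u \in H, b \in H, c \in H & w \in H].
  by split; apply: sH; rewrite !inE eqxx ?orbT.
have uw : u != w by uniq_hyp un.
have [A [sA tA uA wA gA]] := universal_gap uH wH uw nuw.
have [bA cA] := path4_closed sA tA un uA wA bH cH ub bc cw.
have [p [q [pH qH pA qA pq]]] := gA.
have outA z t : z \notin A -> t \in A -> z != t by move=> zA; apply: contraTneq => <-.
have pq' := adj_neq pq.
have [pu pb pc pw] : [/\ p != u, p != b, p != c & p != w] by split; apply: outA.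
have [qu qb qc qw] : [/\ q != u, q != b, q != c & q != w] by split; apply: outA.
have un6 : uniq [:: u; b; c; w; p; q] by uniq_hyp un; uniq_goal.
have s6 : {subset [:: u; b; c; w; p; q] <= H}.
  by apply: sub_all; rewrite /= uH bH cH wH pH qH.
have HE := six_cover un6 erefl s6.
have key p' q' v : adj p' q' -> uniq [:: u; b; c; w; p'; q'] -> p' \in H -> q' \in H ->
    v \in [:: u; b; c; w] -> adj p' v -> False.
  move=> p'q' un' p'H q'H; uniq_hyp un'.
  rewrite ?inE => /or4P[] /eqP-> p'v.
  - apply: (@no_path5 p' u b c w) => //; first by uniq_goal.
    by apply: sub_all; rewrite /= p'H uH bH cH wH.
  - apply: (@no_path5 q' p' b c w) => //; rewrite 1?adj_sym //; first by uniq_goal.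
    by apply: sub_all; rewrite /= q'H p'H bH cH wH.
  - apply: (@no_path5 q' p' c b u) => //; rewrite 1?adj_sym //; first by uniq_goal.
    by apply: sub_all; rewrite /= q'H p'H cH bH uH.
  - apply: (@no_path5 u b c w p') => //; rewrite 1?adj_sym //; first by uniq_goal.
    by apply: sub_all; rewrite /= uH bH cH wH p'H.
have sU : [set p; q] \subset H by rewrite subUset !sub1set pH.
have U0 : [set p; q] != set0 by apply/set0Pn; exists p; rewrite !inE eqxx.
have UH : [set p; q] != H.
  by apply: contraTneq uH => <-; rewrite !inE negb_or !(eq_sym u) !outA.
have [v [s [vU sH' sU' vs]]] := universal_exit sU U0 UH.
have s4 : s \in [:: u; b; c; w].
  by move: sU' sH'; rewrite HE !inE negb_or => /andP[/negPf-> /negPf->]; rewrite !orbF.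
move: vU vs; rewrite !inE => /orP[] /eqP-> vs; first exact: (key p q s).
apply: (key q p s) => //; first by rewrite adj_sym.
by uniq_hyp un6; uniq_goal.
Qed.

(** The path and the gap edge pq are five vertices. To avoid a path on four vertices, an edge
    leaving the path must start at b and lead to a sixth vertex s. An edge leaving {p, q} then ends
    in the star at b and gives such a path. *)
Lemma no_path3 u b w : uniq [:: u; b; w] -> {subset [:: u; b; w] <= H} ->
  adj u b -> adj b w -> False.
Proof.
move=> un sH ub bw.
have nuw : ~~ adj u w by apply: (@universal_nadj u [:: b] w); rewrite //= ub bw.
have [uH bH wH] : [/\ u \in H, b \in H & w \in H].
  by split; apply: sH; rewrite !inE eqxx ?orbT.
have uw : u != w by uniq_hyp un.
have [A [sA tA uA wA gA]] := universal_gap uH wH uw nuw.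
have bA := path3_closed sA tA un uA wA bH ub bw.
have [p [q [pH qH pA qA pq]]] := gA.
have outA z t : z \notin A -> t \in A -> z != t by move=> zA; apply: contraTneq => <-.
have pq' := adj_neq pq.
have [pu pb pw] : [/\ p != u, p != b & p != w] by split; apply: outA.
have [qu qb qw] : [/\ q != u, q != b & q != w] by split; apply: outA.
have un5 : uniq [:: u; b; w; p; q] by uniq_hyp un; uniq_goal.
have p4 (a1 a2 a3 a4 : G) : uniq [:: a1; a2; a3; a4] -> a1 \in H -> a2 \in H -> a3 \in H ->
    a4 \in H -> adj a1 a2 -> adj a2 a3 -> adj a3 a4 -> False.
  move=> una h1 h2 h3 h4; apply: no_path4 => //.
  by apply: sub_all; rewrite /= h1 h2 h3 h4.
have [v [s [vW sH' sW vs]]] : exists v s,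
    [/\ v \in [set u; b; w], s \in H, s \notin [set u; b; w] & adj v s].
  apply: universal_exit; first by rewrite !subUset !sub1set uH bH.
    by apply/set0Pn; exists u; rewrite !inE eqxx.
  by apply: contraTneq pH => <-; rewrite !inE !negb_or !outA.
have [v' [s' [vU sH2 sU vs']]] : exists v s,
    [/\ v \in [set p; q], s \in H, s \notin [set p; q] & adj v s].
  apply: universal_exit; first by rewrite !subUset !sub1set pH.
    by apply/set0Pn; exists p; rewrite !inE eqxx.
  by apply: contraTneq uH => <-; rewrite !inE !negb_or !(eq_sym u) !outA.
have qp : adj q p by rewrite adj_sym.
have bu : adj b u by rewrite adj_sym.
uniq_hyp un5.
have vb : v = b.
  move: vW vs sW; rewrite !inE !negb_or -orbA => /or3P[] /eqP-> // vs /andP[/andP[su sb] sw].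
    by case: (@p4 s u b w) => //; [uniq_goal|rewrite adj_sym].
  by case: (@p4 u b w s) => //; uniq_goal.
subst v; move: sW; rewrite !inE !negb_or => /andP[/andP[su sb] sw].
have sb' : adj s b by rewrite adj_sym.
have sp : s != p.
  by apply/eqP=> sp; subst s; case: (@p4 q p b u) => //; uniq_goal.
have sq : s != q.
  by apply/eqP=> sq; subst s; case: (@p4 p q b u) => //; uniq_goal.
have key p' q' : adj p' q' -> uniq [:: u; b; w; p'; q'; s] -> p' \in H -> q' \in H ->
    s' \notin [set p'; q'] -> adj p' s' -> False.
  move=> p'q' un6 p'H q'H s'U p's'.
  have s6 : {subset [:: u; b; w; p'; q'; s] <= H}.
    by apply: sub_all; rewrite /= uH bH wH p'H q'H sH'.
  have := six_cover un6 erefl s6 s'; rewrite sH2 !inE; uniq_hyp un6.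
  have q'p' : adj q' p' by rewrite adj_sym.
  move: s'U; rewrite !inE negb_or => /andP[/negPf-> /negPf->] /=.
  move/esym=> /or4P[] /eqP s'E; subst s'.
  - by case: (@p4 p' u b w) => //; uniq_goal.
  - by case: (@p4 q' p' b u) => //; uniq_goal.
  - by case: (@p4 p' w b u) => //; [uniq_goal|rewrite adj_sym].
  - by case: (@p4 p' s b u) => //; uniq_goal.
move: vU vs'; rewrite !inE => /orP[] /eqP-> vs'.
  by apply: (key p q) => //; uniq_goal.
by apply: (key q p) => //; [uniq_goal|rewrite setUC].
Qed.

Lemma universal_small : False.
Proof.
have H0 : H != set0 by rewrite -card_gt0 universal_card; nlia.
have dH := acyc_tight acH H0 (conn_tight universal_conn).
have [/exists_inP[b bH]|/exists_inPn small] := boolP [exists b in H, 1 < deg b H].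
  case/deg_gt1P=> u [w [uH wH uw bu bw]].
  have ub := adj_neq bu; have wb := adj_neq bw.
  apply: (@no_path3 u b w) => //; last by rewrite adj_sym.
    by uniq_goal.
  by apply: sub_all; rewrite /= uH bH wH.
have : darts H <= \sum_(b in H) 1 by apply: leq_sum => b /small; rewrite -leqNgt.
by rewrite sum1_card; have := universal_card; nlia.
Qed.

End UniversalVertex.

(** The edge number 2n - 3 lies in [n + 5, 2n - 2] exactly when n is at least 8, which is why small
    n must be excluded. *)
Lemma universal_edges (G : sgraph) (x : G) : sat G -> ~~ cyc (~: [set x]) -> 5 < #|G| ->
  darts [set: G] + 6 = 4 * #|G| /\ 7 < #|G|.
Proof.
move=> satG acH n6; split; last first.
  by rewrite ltnNge; apply/negP; apply: universal_small acH n6.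
have := cardT_C1 x; rewrite (dartsT_C1 x).
have H0 : ~: [set x] != set0 by rewrite -card_gt0; have := cardT_C1 x; nlia.
have := acyc_tight acH H0 (conn_tight (universal_conn satG acH)).
rewrite (deg_all (A := ~: [set x])); first by nlia.
by move=> u; rewrite !inE => ux; apply: universal_adj.
Qed.

(** * No two vertices meeting all cycles *)

Section MinDegreeThree.
Variables (G : sgraph) (V : {set G}).
Implicit Types (A B C D E F R U W X : {set G}) (a b c d p q s t u v w x y z : G).
Hypothesis n2 : no_two_cyc V.
Hypothesis no_fvs2 : forall x y, cyc (V :\: [set x; y]).
Hypothesis deg3 : forall v, v \in V -> 3 <= deg v V.

Lemma disjoint_acyc A B :
  A \subset V -> B \subset V -> [disjoint A & B] -> cyc B -> ~~ cyc A.
Proof. by move=> sA sB dAB cB; apply: n2 cB; rewrite // disjoint_sym. Qed.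

Lemma shortest_cyc : cyc V ->
  exists C, [/\ C \subset V, mincyc C & forall D, D \subset V -> cyc D -> #|C| <= #|D|].
Proof.
move=> cV; pose P D := (D \subset V) && cyc D.
have PV : P V by rewrite /P subxx.
case: (arg_minnP (fun D : {set G} => #|D|) PV) => D /andP[sDV cD] minD.
have [C sCD mC] := mincyc_exists cD; exists C; split=> //.
  exact: subset_trans sDV.
move=> E sEV cE; apply: leq_trans (subset_leq_card sCD) (minD E _).
by rewrite /P sEV.
Qed.

(** With the tree D contracted to a point, W1 and W2 meet only there. In counts: a cycle E meeting D
    would, by supermodularity, make its union with D too dense for two forests sharing the tree
    D. *)
Lemma acyc_glue W1 W2 D : tight D -> D != set0 -> [disjoint W1 & D] -> [disjoint W2 & D] ->
  [disjoint W1 & W2] -> arcs W1 W2 = 0 ->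
  ~~ cyc (W1 :|: D) -> ~~ cyc (W2 :|: D) -> ~~ cyc (W1 :|: W2 :|: D).
Proof.
move=> tD D0 d1 d2 d12 a12 ac1 ac2; apply/negP=> /mincyc_exists[E sE mE].
have acW1 : ~~ cyc W1 by apply: acycS ac1; apply: subsetUl.
have acW2 : ~~ cyc W2 by apply: acycS ac2; apply: subsetUl.
have acD : ~~ cyc D by apply: acycS ac1; apply: subsetUr.
have [ED0|ED0] := eqVneq (E :&: D) set0.
  have dED : [disjoint E & D] by rewrite -setI_eq0 ED0.
  case/negP: (acyc_U acW1 acW2 a12); apply: cycS (mincyc_cyc mE).
  by clear ED0; set_auto.
have acED : ~~ cyc (E :&: D) by apply: acycS acD; apply: subsetIr.
have := acyc_darts acED ED0; have := darts_supermod E D; have := cardsUI E D.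
pose X1 := E :&: W1; pose X2 := E :&: W2.
have sX1 : X1 \subset W1 by apply: subsetIr.
have sX2 : X2 \subset W2 by apply: subsetIr.
have -> : E :|: D = D :|: (X1 :|: X2) by rewrite /X1 /X2; clear ED0; set_auto.
have d12' : [disjoint X1 & X2] by rewrite /X1 /X2; set_auto.
have dX1 : [disjoint D & X1] by rewrite /X1; set_auto.
have dX2 : [disjoint D & X2] by rewrite /X2; set_auto.
have dX : [disjoint D & X1 :|: X2] by rewrite /X1 /X2; set_auto.
have aX : arcs X1 X2 = 0 by apply/eqP; rewrite -leqn0 -a12 arcsS.
have [acX1 acX2] : ~~ cyc (D :|: X1) /\ ~~ cyc (D :|: X2).
  split; first by apply: acycS ac1; rewrite setUC setSU.
  by apply: acycS ac2; rewrite setUC setSU.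
have DX0 X : D :|: X != set0 by rewrite setU_eq0 negb_and D0.
have := acyc_darts acX1 (DX0 X1); have := acyc_darts acX2 (DX0 X2).
move: tD; rewrite (mincyc_darts mE) /tight !darts_U // !card_disjU // arcsUr // aX.
nlia.
Qed.

Section Shortest.
Variable C : {set G}.
Hypotheses (sCV : C \subset V) (mC : mincyc C).
Hypothesis minC : forall D, D \subset V -> cyc D -> #|C| <= #|D|.
Let F := V :\: C.

Lemma forest_compl : ~~ cyc F.
Proof.
apply: (disjoint_acyc _ sCV _ (mincyc_cyc mC)); first exact: subsetDl.
by rewrite /F; set_auto.
Qed.

Lemma compl_neq0 : F != set0.
Proof.
case/set0Pn: (mincyc_neq0 mC) => v vC; apply/negP=> /eqP F0.
have := deg3 (subsetP sCV v vC).
by rewrite (degD v sCV) -/F F0 deg0 (mincyc_deg mC vC).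
Qed.

(** Degrees in W sum to at least 3|W|, and the forest W accounts for at most 2|W| - 2 of this. *)
Lemma closed_arcs W : W \subset F -> W != set0 -> arcs W (F :\: W) = 0 -> 3 <= arcs W C.
Proof.
move=> sWF W0 a0; have acW : ~~ cyc W by apply: acycS forest_compl.
have : \sum_(v in W) 3 <= arcs W V.
  by apply: leq_sum => v /(subsetP sWF); rewrite inE => /andP[_]; apply: deg3.
rewrite sum_nat_const arcsC (arcsD W sCV) (arcsD W sWF) -/F (arcsC _ W) (arcsC _ W) a0.
have := acyc_darts acW W0; rewrite -/(darts W) arcsC; move: W0; rewrite -card_gt0.
by rewrite (arcsC C W); nlia.
Qed.

(** Suppose F has components W1 and W. Each sends at least three edges to C, so at least two to A or
    to B, closing a cycle with that half. Disjointness forces both to use the same half, and neither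
    side of F closes a cycle with the other half. By [acyc_glue] F and that half form a forest,
    although they are all of V except one half of C. *)
Lemma tight_compl A B : A :|: B = C -> [disjoint A & B] -> tight A -> tight B ->
  A != set0 -> B != set0 -> cyc (V :\: A) -> cyc (V :\: B) -> tight F.
Proof.
move=> AB dAB tA tB A0 B0 cVA cVB.
have [w wF] : exists w, w \in F by apply/set0Pn; apply: compl_neq0.
have [W1 [wW1 sW1 tW1 a0]] := component wF; pose W2 := F :\: W1.
have [W20|/set0Pn[w2 w2W2]] := eqVneq W2 set0.
  suff -> : F = W1 by [].
  by apply/eqP; rewrite eqEsubset sW1 andbT -setD_eq0 -/W2 W20.
have [W [wW sW tW aW]] := component w2W2.
have sW2F : W2 \subset F by apply: subsetDl.
have sWF : W \subset F by apply: subset_trans sW sW2F.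
have d12 : [disjoint W1 & W2] by rewrite /W2; set_auto.
have aWF : arcs W (F :\: W) = 0.
  have d1W : [disjoint W1 & W] by apply: disjointWr d12.
  have -> : F :\: W = W1 :|: (W2 :\: W) by rewrite /W2; clear aW tW; set_auto.
  rewrite arcsUr; last by rewrite /W2; set_auto.
  rewrite aW addn0; apply/eqP; rewrite -leqn0 -[0]a0 arcsC.
  exact: arcsS.
have F12 : F = W1 :|: W2 by rewrite /W2; set_auto.
have sAC : A \subset C by rewrite -AB subsetUl.
have sBC : B \subset C by rewrite -AB subsetUr.
have FC : [disjoint F & C] by rewrite /F; set_auto.
have sFV : F \subset V by apply: subsetDl.
have arcsAB U : arcs U C = arcs U A + arcs U B by rewrite -AB arcsUr.
have W10 : W1 != set0 by apply/set0Pn; exists w.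
have W0 : W != set0 by apply/set0Pn; exists w2.
have c1 := closed_arcs sW1 W10 a0; have c2 := closed_arcs sWF W0 aWF.
have dFC U D : U \subset F -> D \subset C -> [disjoint U & D].
  by move=> sU sD; apply: disjointWl sU (disjointWr sD FC).
have half U D : U \subset F -> U != set0 -> tight U -> D \subset C -> D != set0 -> tight D ->
    ~~ cyc (U :|: D) -> arcs U D <= 1.
  move=> sU U0 tU sD D0 tD acUD; have dUD := dFC U D sU sD.
  have := acyc_darts acUD; rewrite setU_eq0 negb_and U0 => /(_ isT).
  by move: tU tD; rewrite /tight darts_U // card_disjU //; nlia.
have half_cyc U D : U \subset F -> U != set0 -> tight U -> D \subset C -> D != set0 -> tight D ->
    2 <= arcs U D -> cyc (U :|: D).
  by move=> *; apply: contraT => /half; rewrite leqNgt => /(_ _ _ _ _ _ _)/negP[].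
have opp U U' : U \subset F -> U' \subset F -> [disjoint U & U'] -> forall D D',
    D \subset C -> D' \subset C -> [disjoint D & D'] -> cyc (U :|: D) -> ~~ cyc (U' :|: D').
  move=> sU sU' dU D D' sD sD' dD cUD.
  apply: (disjoint_acyc _ _ _ cUD).
  - by rewrite subUset (subset_trans sU' sFV) (subset_trans sD' sCV).
  - by rewrite subUset (subset_trans sU sFV) (subset_trans sD sCV).
  have := dFC U D' sU sD'; have := dFC U' D sU' sD => d1 d2.
  by set_auto.
have dBA : [disjoint B & A] by rewrite disjoint_sym.
have VA : V :\: A = F :|: B.
  by rewrite /F -AB; move: sAC sBC; rewrite -AB => sA sB; have := sCV; rewrite -AB => sV; set_auto.
have VB : V :\: B = F :|: A.
  by rewrite /F -AB; move: sAC sBC; rewrite -AB => sA sB; have := sCV; rewrite -AB => sV; set_auto.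
have dW1W : [disjoint W1 & W] by apply: disjointWr d12.
have dWW1 : [disjoint W & W1] by rewrite disjoint_sym.
have [c1A|ac1A] := boolP (cyc (W1 :|: A)).
  have ac2B := opp _ _ sW1 sW2F d12 _ _ sAC sBC dAB c1A.
  have acWB : ~~ cyc (W :|: B) by apply: acycS ac2B; apply: setSU.
  have aWB := half _ _ sWF W0 tW sBC B0 tB acWB.
  have cWA : cyc (W :|: A).
    by apply: half_cyc => //; have := arcsAB W; nlia.
  have ac1B := opp _ _ sWF sW1 dWW1 _ _ sAC sBC dAB cWA.
  by have := acyc_glue tB B0 (dFC _ _ sW1 sBC) (dFC _ _ sW2F sBC) d12 a0 ac1B ac2B;
    rewrite -F12 -VA cVA.
have a1A := half _ _ sW1 W10 tW1 sAC A0 tA ac1A.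
have c1B : cyc (W1 :|: B) by apply: half_cyc => //; have := arcsAB W1; nlia.
have ac2A := opp _ _ sW1 sW2F d12 _ _ sBC sAC dBA c1B.
by have := acyc_glue tA A0 (dFC _ _ sW1 sAC) (dFC _ _ sW2F sAC) d12 a0 ac1A ac2A;
  rewrite -F12 -VB cVB.
Qed.

Lemma compl_leaf : exists v, [/\ v \in F, deg v F <= 1 & 2 <= deg v C].
Proof.
have [v vF dv] := acyc_leaf forest_compl compl_neq0; exists v; split=> //.
have vV : v \in V by move: vF; rewrite inE => /andP[].
by have := deg3 vV; rewrite (degD v sCV) -/F; nlia.
Qed.

(** A leaf v of F has two neighbours on C. If C has at least five vertices, some edge pq of C avoids
    both; then C without p and q, together with v, carries a cycle on at most |C| - 1 vertices. *)
Lemma card_shortest : #|C| <= 4.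
Proof.
rewrite leqNgt; apply/negP=> C5.
have [v [vF _ /deg_gt1P[p1 [p2 [p1C p2C p12 vp1 vp2]]]]] := compl_leaf.
have [vV vC] : v \in V /\ v \notin C by move: vF; rewrite inE => /andP[].
pose P := [set p1; p2]; pose R := C :\: P.
have sP : P \subset C by rewrite subUset !sub1set p1C.
have arcsPC p q : p \in C -> q \in C -> p != q -> arcs [set p; q] C = 4.
  by move=> pC qC pq; rewrite arcs1U ?inE // arcs1 !(mincyc_deg mC).
have dC := mincyc_darts mC.
have splitC p q : p \in C -> q \in C -> p != q ->
    2 * #|C| <= darts (C :\: [set p; q]) + 8 /\
    (adj p q -> 2 * #|C| <= darts (C :\: [set p; q]) + 6).
  move=> pC qC pq; have sPQ : [set p; q] \subset C by rewrite subUset !sub1set pC.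
  have e : darts [set p; q] + arcs [set p; q] (C :\: [set p; q]) = 4.
    by rewrite -(arcsPC p q) // [RHS]arcsC (arcsD _ sPQ) [in RHS](arcsC (C :\: _)).
  have := dartsD sPQ; rewrite dC; split; first by nlia.
  by move=> apq; have := darts2 apq; nlia.
have /darts_gt0P[p [q [pR qR pq]]] : 0 < darts R.
  by have [+ _] := splitC _ _ p1C p2C p12; rewrite -/P -/R; nlia.
have [pC qC] : p \in C /\ q \in C by move: pR qR; rewrite !in_setD => /andP[_ ->] /andP[_ ->].
have sPQ : [set p; q] \subset C by rewrite subUset !sub1set pC.
have [_ /(_ pq) dD] := splitC _ _ pC qC (adj_neq pq).
set D := C :\: [set p; q] in dD.
have vD : v \notin D by apply: contra vC; apply/subsetP; apply: subsetDl.
have cD : #|D| + 2 = #|C|.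
  by rewrite (card_D sPQ) cards2 (adj_neq pq) addnC.
have dv : 2 <= deg v D.
  apply/deg_gt1P; exists p1, p2; split=> //; rewrite !inE ?p1C ?p2C andbT.
    move: pR qR; rewrite !inE !negb_or !(eq_sym p1) => /andP[/andP[-> _] _] /andP[/andP[-> _] _] //.
  by move: pR qR; rewrite !inE !negb_or !(eq_sym p2) => /andP[/andP[_ ->] _] /andP[/andP[_ ->] _].
have : #|C| <= #|v |: D|.
  apply: minC; first by rewrite subUset sub1set vV (subset_trans (subsetDl _ _) sCV).
  apply: (cycI (B := v |: D)) => //; first by apply/set0Pn; exists v; rewrite setU11.
  by rewrite cardsU1 vD darts_U1 //; nlia.
by rewrite cardsU1 vD; nlia.
Qed.

Lemma triangle_cyc a b c : adj a b -> adj b c -> adj a c -> cyc [set a; b; c].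
Proof.
move=> ab bc ac; have -> : [set a; b; c] = [set z in a :: rcons [:: b] c].
  by apply/setP=> z; rewrite !inE orbA.
apply: closed_path_cyc; rewrite //= ?ab ?bc //; last by rewrite adj_sym.
by rewrite !inE negb_or (adj_neq ab) (adj_neq ac) (adj_neq bc).
Qed.

Lemma square_cyc a b c d : adj a b -> adj b c -> adj c d -> adj d a -> a != c -> b != d ->
  cyc [set a; b; c; d].
Proof.
move=> ab bc cd da ac bd; have -> : [set a; b; c; d] = [set z in a :: rcons [:: b; c] d].
  by apply/setP=> z; rewrite !inE !orbA.
apply: closed_path_cyc; rewrite //= ?ab ?bc ?cd //.
by rewrite !inE !negb_or (adj_neq ab) ac eq_sym (adj_neq da) (adj_neq bc) bd (adj_neq cd).
Qed.

Lemma tight_pair a b : adj a b -> tight [set a; b].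
Proof. by move=> ab; rewrite /tight darts2 // cards2 (adj_neq ab). Qed.

Lemma tight_leaf v : tight F -> v \in F -> deg v F <= 1 -> tight (F :\ v).
Proof. by rewrite /tight => tF vF dv; have := darts_D1 vF; have := cardsD1 v F; rewrite vF; nlia. Qed.

Lemma apex_cyc s W : tight W -> s \notin W -> 2 <= deg s W -> cyc (s |: W).
Proof.
move=> tW sW ds; apply: (cycI (B := s |: W)) => //; first by apply/set0Pn; exists s; rewrite setU11.
by move: tW; rewrite /tight cardsU1 sW darts_U1 //; nlia.
Qed.

(** There are no triangles, so the two neighbours p1, p2 of the leaf v are opposite on C. If b had
    two neighbours in F, one of them would not be v, and indeed both lie in the tree F - v, giving a
    cycle disjoint from the square v, p1, d, p2; likewise for d. So F with b and d is a forest, and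
    p1, p2 meet all cycles. *)
Lemma shortest_square : #|C| = 4 -> False.
Proof.
move=> C4; have [v [vF dvF /deg_gt1P[p1 [p2 [p1C p2C p12 vp1 vp2]]]]] := compl_leaf.
have [vV vC] : v \in V /\ v \notin C by move: vF; rewrite inE => /andP[].
have no_triangle a b c : a \in V -> b \in V -> c \in V -> adj a b -> adj b c -> ~~ adj a c.
  move=> aV bV cV ab bc; apply/negP=> ac; have := minC _ (triangle_cyc ab bc ac).
  rewrite !subUset !sub1set aV bV cV C4 => /(_ isT).
  have := subset_leq_card (subxx [set a; b; c]).
  by rewrite -{2}setUA cardsU1 cards2; case: (_ \notin _); case: (_ != _); nlia.
have CV u : u \in C -> u \in V by apply: (subsetP sCV).
have np12 : ~~ adj p1 p2 by apply: (no_triangle _ v) => //; rewrite 1?adj_sym //; apply: CV.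
have := mincyc_deg_le mC p1C => /deg_gt1P[b [d [bC dC bd p1b p1d]]].
have bp2 : b != p2 by apply: contraNneq np12 => <-.
have dp2 : d != p2 by apply: contraNneq np12 => <-.
have p1bn := adj_neq p1b; have p1dn := adj_neq p1d.
have p2b' : p2 != b by rewrite eq_sym.
have p2d' : p2 != d by rewrite eq_sym.
have CE : C = p1 |: (p2 |: (b |: [set d])).
  apply/eqP; rewrite eq_sym eqEcard !subUset !sub1set p1C p2C bC dC C4 /=.
  by rewrite !cardsU1 !inE !negb_or cards1 p12 p1bn p1dn p2b' p2d' bd.
have n1 : p1 \notin p2 |: (b |: [set d]) by rewrite !inE !negb_or p12 p1bn p1dn.
have n2' : p2 \notin b |: [set d] by rewrite !inE !negb_or p2b' p2d'.
have n3 : b \notin [set d] by rewrite inE.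
have degC u : u \in C -> adj u p1 + (adj u p2 + (adj u b + adj u d)) = 2.
  by move=> uC; rewrite -(mincyc_deg mC uC) CE !degU1 // /deg big_set1.
have := degC _ p2C; rewrite adj_irr (adj_sym p2 p1) (negPf np12) /= => d2.
have p2b : adj p2 b by move: d2; case: (adj p2 b); case: (adj p2 d).
have p2d : adj p2 d by move: d2; case: (adj p2 b); case: (adj p2 d).
have nbd : ~~ adj b d.
  by have := degC _ bC; rewrite adj_irr adj_sym p1b adj_sym p2b; case: (adj b d).
have nvb : ~~ adj v b by apply: (no_triangle _ p1) => //; apply: CV.
have nvd : ~~ adj v d by apply: (no_triangle _ p1) => //; apply: CV.
have tF : tight F.
  apply: (@tight_compl [set p1; b] [set p2; d]).
  - by rewrite CE; apply/setP=> z; rewrite !inE; do 4 case: eqP.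
  - by clear -p12 p1dn bp2 bd; set_auto.
  - exact: tight_pair.
  - exact: tight_pair.
  - by apply/set0Pn; exists p1; rewrite !inE eqxx.
  - by apply/set0Pn; exists p2; rewrite !inE eqxx.
  - exact: no_fvs2.
  - exact: no_fvs2.
have tFv := tight_leaf tF vF dvF.
have CF u : u \in C -> u \notin F by rewrite inE => ->.
have deg_le t t' : t \in C -> t' \in C -> t != t' -> adj p1 t -> adj p2 t -> p1 != t' -> p2 != t' ->
    ~~ adj v t' ->
    deg t' F <= 1.
  move=> tC t'C tt' p1t p2t p1t' p2t' nvt'.
  have vt : v != t by apply: contraNneq vC => ->.
  have vt' : v != t' by apply: contraNneq vC => ->.
  rewrite -(setD1K vF) degU1 ?setD11 // adj_sym (negPf nvt') leqNgt; apply/negP=> d2'.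
  have t'F : t' \notin F :\ v by rewrite inE negb_and CF ?orbT.
  have cA := apex_cyc tFv t'F d2'.
  have : ~~ cyc [set v; p1; t; p2].
    apply: (disjoint_acyc _ _ _ cA).
    - by rewrite !subUset !sub1set vV !CV.
    - by rewrite subUset sub1set CV // (subset_trans (subsetDl _ _) (subsetDl _ _)).
    have [p1F p2F tF'] : [/\ p1 \notin F, p2 \notin F & t \notin F] by rewrite !CF.
    by clear -vt' p1t' p2t' tt' p1F p2F tF'; set_auto.
  by rewrite square_cyc // 1?adj_sym.
have db : deg b F <= 1 by apply: (deg_le d b); rewrite // eq_sym.
have dd : deg d F <= 1 by apply: (deg_le b d).
have : ~~ cyc (b |: (d |: F)).
  apply: acyc_U1; first by apply: acyc_U1 dd; apply: forest_compl.
  by rewrite degU1 ?CF // (negPf nbd).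
move/negP; apply; apply: cycS (no_fvs2 p1 p2); apply/subsetP=> u.
rewrite !inE CE !inE !negb_or => /andP[/andP[-> ->] ->] /=.
by case: (u == b); case: (u == d).
Qed.

(** Each vertex of C has at least two neighbours in the tree F, since otherwise the other two
    vertices of C meet all cycles. The leaf v bounds these numbers from above, so 3 + 6 + (|F| - 1)
    = |V| + 5 edges result. *)
Lemma shortest_triangle : #|C| = 3 -> darts V = 2 * #|V| + 10.
Proof.
move=> C3; case/set0Pn: (mincyc_neq0 mC) => a aC.
have := mincyc_deg_le mC aC => /deg_gt1P[b [c [bC cC bc' ab ac]]].
have CE : C = a |: (b |: [set c]).
  apply/eqP; rewrite eq_sym eqEcard !subUset !sub1set aC bC cC C3 /=.
  by rewrite !cardsU1 !inE !negb_or cards1 (adj_neq ab) (adj_neq ac) bc'.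
have n1 : a \notin b |: [set c] by rewrite !inE !negb_or (adj_neq ab) (adj_neq ac).
have n3 : b \notin [set c] by rewrite inE.
have bc : adj b c.
  have := mincyc_deg mC bC; rewrite CE !degU1 // {1}/deg big_set1 adj_irr.
  by case: (adj b a); case: (adj b c).
have [v [vF dvF dvC]] := compl_leaf.
have [vV vC] : v \in V /\ v \notin C by move: vF; rewrite inE => /andP[].
have CF u : u \in C -> u \notin F by rewrite inE => ->.
have CV u : u \in C -> u \in V by apply: (subsetP sCV).
have tF : tight F.
  apply: (@tight_compl [set a; b] [set c]).
  - by rewrite CE setUA.
  - by have acn := adj_neq ac; clear -bc' acn; set_auto.
  - exact: tight_pair.
  - exact: tight1.
  - by apply/set0Pn; exists a; rewrite !inE eqxx.
  - by apply/set0Pn; exists c; rewrite !inE eqxx.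
  - exact: no_fvs2.
  - by have := no_fvs2 c c; rewrite setUid.
have tFv := tight_leaf tF vF dvF.
have deg_ge s t u : C = s |: (t |: [set u]) -> 2 <= deg s F.
  move=> CE'; rewrite ltnNge; apply/negP=> ds; case/negP: (acyc_U1 forest_compl ds).
  apply: cycS (no_fvs2 t u); apply/subsetP=> z.
  by rewrite !inE CE' !inE !negb_or => /andP[/andP[-> ->] ->]; rewrite !andbT; case: (z == s).
have deg_le s t u : C = s |: (t |: [set u]) -> adj t u -> 2 <= deg s (F :\ v) ->
    adj v t + adj v u <= 1.
  move=> CE' tu ds.
  have [sC tC uC] : [/\ s \in C, t \in C & u \in C] by rewrite CE' !inE !eqxx ?orbT.
  case: (boolP (adj v t)) => vt; case: (boolP (adj v u)) => vu //.
  have sF : s \notin F :\ v by rewrite inE negb_and CF ?orbT.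
  have cA := apex_cyc tFv sF ds.
  have : ~~ cyc [set v; t; u]; last by rewrite triangle_cyc.
  apply: (disjoint_acyc _ _ _ cA).
  - by rewrite !subUset !sub1set vV !CV.
  - by rewrite subUset sub1set CV // (subset_trans (subsetDl _ _) (subsetDl _ _)).
  have [tF' uF] : t \notin F /\ u \notin F by rewrite !CF.
  have vs : v != s by apply: contraNneq vC => ->.
  have : #|C| = 3 by []; rewrite CE' !cardsU1 cards1 !inE negb_or.
  case: (eqVneq s t) => [|st]; first by case: (_ == _); case: (_ == _).
  case: (eqVneq s u) => [|su _]; first by case: (_ == _).
  by clear -tF' uF vs st su; set_auto.
have CEb : C = b |: (a |: [set c]) by rewrite CE setUCA.
have CEc : C = c |: (a |: [set b]).
  by rewrite CE; apply/setP=> z; rewrite !inE; do 3 case: eqP.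
have ga := deg_ge _ _ _ CE; have gb := deg_ge _ _ _ CEb; have gc := deg_ge _ _ _ CEc.
have la := deg_le _ _ _ CE bc; have lb := deg_le _ _ _ CEb ac; have lc := deg_le _ _ _ CEc ab.
have degF s : deg s F = adj v s + deg s (F :\ v).
  by rewrite -{1}(setD1K vF) degU1 ?setD11 // adj_sym.
move: dvC; rewrite CE !degU1 // {1}/deg big_set1 => dvC.
(* If v misses s in C, it sees the other two, so s has at most one neighbour in F - v and none at v,
   which is too few. Hence v sees all of C, and each vertex of C has exactly one more neighbour in
   F. *)
have three : [/\ deg a F = 2, deg b F = 2 & deg c F = 2].
  move: ga gb gc la lb lc dvC; rewrite !degF; clear.
  by case: (adj v a); case: (adj v b); case: (adj v c) => /= *; split; lia.
have sF := compl_neq0; have dF := acyc_tight forest_compl sF tF.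
have aCF : arcs C F = 6.
  by case: three => da db dc; rewrite CE !arcs1U // arcs1 da db dc.
by rewrite (dartsD sCV) -/F (card_D sCV) -/F aCF (mincyc_darts mC) C3; nlia.
Qed.

End Shortest.

Lemma min_degree3_edges : cyc V -> darts V = 2 * #|V| + 10.
Proof.
move=> cV; have [C [sCV mC minC]] := shortest_cyc cV.
have := card_shortest sCV mC minC; have := mincyc_card mC.
have [C4|nC4] := eqVneq #|C| 4; first by case: (shortest_square sCV mC minC C4).
move=> C3 C4; apply: (shortest_triangle sCV mC); move: nC4 C3 C4; lia.
Qed.

End MinDegreeThree.

(** * Suppressing a vertex of degree two *)

Section SuppressVertex.
Variables (G : sgraph) (V : {set G}) (v p q : G).
Implicit Types (A B C D : {set G}).
Hypotheses (vV : v \in V) (pV : p \in V) (qV : q \in V) (pq : p != q) (npq : ~~ adj p q).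
Hypotheses (vp : adj v p) (vq : adj v q) (dv : deg v V = 2).

Lemma suppress_nbr u : u \in V -> adj v u -> (u == p) || (u == q).
Proof.
move=> uV vu; apply: contraT; rewrite negb_or => /andP[up uq].
have : deg v [set u; p; q] <= 2.
  by rewrite -dv degS // !subUset !sub1set uV pV qV.
rewrite -setUA degU1 ?inE ?negb_or ?up // degU1 ?inE // /deg big_set1.
by rewrite vu vp vq.
Qed.

(** The new edge pq is replaced by the path through v; if the cycle does not use pq, the extra
    vertex does no harm. *)
Lemma suppress_lift A : A \subset V :\ v -> @cyc (add_edge p q) A ->
  cyc (if (p \in A) && (q \in A) then v |: A else A).
Proof.
move=> sA /(cyc_add pq npq)[cA|[D [sDA pD qD tD]]].
  by case: ifP => // _; apply: cycS cA; apply: subsetUr.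
rewrite (subsetP sDA _ pD) (subsetP sDA _ qD) /=.
have vD : v \notin D.
  by apply/negP=> /(subsetP sDA) /(subsetP sA); rewrite !inE eqxx.
have d2 : 1 < deg v D by apply/deg_gt1P; exists p, q.
apply: (cycI (B := v |: D)); first exact: setUS.
  by apply/set0Pn; exists v; rewrite setU11.
by move: tD; rewrite /tight cardsU1 vD darts_U1 //; nlia.
Qed.

(** Only one of two disjoint sets can contain p, so at most one of the lifted sets contains v. *)
Lemma suppress_no_two_cyc : no_two_cyc V -> no_two_cyc (G := add_edge p q) (V :\ v).
Proof.
move=> n2 A0 B0; pose A : {set G} := A0; pose B : {set G} := B0.
rewrite -[A0]/A -[B0]/B => sA sB dAB cA; apply/negP=> cB.
have sAV : A \subset V by apply: subset_trans sA (subsetDl _ _).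
have sBV : B \subset V by apply: subset_trans sB (subsetDl _ _).
have vA : v \notin A by apply/negP=> /(subsetP sA); rewrite !inE eqxx.
have vB : v \notin B by apply/negP=> /(subsetP sB); rewrite !inE eqxx.
have := suppress_lift sB cB; have := suppress_lift sA cA.
set A' := if _ then _ else _; set B' := if _ then _ else _ => cA' cB'.
have sA'V : A' \subset V by rewrite /A'; case: ifP; rewrite // subUset sub1set vV.
have sB'V : B' \subset V by rewrite /B'; case: ifP; rewrite // subUset sub1set vV.
suff dAB' : [disjoint A' & B'] by have := n2 _ _ sA'V sB'V dAB' cA'; rewrite cB'.
rewrite /A' /B'; case: ifP => [/andP[pA _]|_].
  by rewrite (disjointFr dAB pA) /=; clear -vB dAB; set_auto.
by case: ifP => // _; clear -vA dAB; set_auto.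
Qed.

(** A cycle through v contains p and q; without v it is tight, and the edge pq closes it again. *)
Lemma suppress_cyc x y : cyc (V :\: [set x; y]) ->
  @cyc (add_edge p q) (V :\ v :\: [set x; y]).
Proof.
move=> /mincyc_exists[C sC mC]; have cC := mincyc_cyc mC.
have sCV : C \subset V by apply: subset_trans sC (subsetDl _ _).
have [vC|vC] := boolP (v \in C); last first.
  have sC' : C \subset V :\ v :\: [set x; y] by clear -sC vC; set_auto.
  by apply: (@cycS (add_edge p q) C _ sC'); apply: cyc_addW.
have /deg_gt1P[u [w [uC wC uw vu vw]]] := mincyc_deg_le mC vC.
have Eu := suppress_nbr (subsetP sCV u uC) vu.
have Ew := suppress_nbr (subsetP sCV w wC) vw.
have [pC qC] : p \in C /\ q \in C.
  by move: uw uC wC; case/orP: Eu => /eqP->; case/orP: Ew => /eqP->; rewrite ?eqxx.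
have vp' := adj_neq vp; have vq' := adj_neq vq.
have pC' : p \in C :\ v by rewrite !inE eq_sym vp'.
have qC' : q \in C :\ v by rewrite !inE eq_sym vq'.
have sC' : C :\ v \subset V :\ v :\: [set x; y] by clear -sC; set_auto.
apply: (@cycS (add_edge p q) (C :\ v) _ sC'); apply: cyc_addI => //.
have := mincyc_darts mC; rewrite (darts_D1 vC) (mincyc_deg mC vC).
by rewrite (cardsD1 v C) vC /tight; nlia.
Qed.

End SuppressVertex.

(** Suppression changes the graph, so the induction runs over G and V together. Deleting a vertex of
    degree at most 1 preserves only the upper bound for V, so the lower bound is kept for a core B
    and is carried over to the whole graph later by connectivity. *)
Lemma no_fvs2_edges n (G : sgraph) (V : {set G}) : #|V| <= n ->
  no_two_cyc V -> cyc V -> (forall x y, cyc (V :\: [set x; y])) ->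
  darts V <= 2 * #|V| + 10 /\
  exists B : {set G}, [/\ B \subset V, B != set0 & 2 * #|B| + 10 <= darts B].
Proof.
elim: n G V => [|n IHn] G V leV n2 cV no2.
  move: leV; rewrite leqn0 cards_eq0 => /eqP V0; move: cV; rewrite V0 => /existsP[B].
  by rewrite subset0 => /and3P[/eqP->]; rewrite eqxx.
have [/exists_inP[v vV dv]|/exists_inPn big] := boolP [exists v in V, deg v V <= 2]; last first.
  have deg3 v : v \in V -> 2 < deg v V by move=> /big; rewrite -ltnNge.
  have dV := min_degree3_edges n2 no2 deg3 cV.
  split; first by rewrite dV.
  exists V; split; rewrite ?dV //.
  by apply: contraTneq cV => ->; apply: card_acyc2; rewrite cards0.
have cardV := cardsD1 v V; rewrite vV in cardV.
have leV' : #|V :\ v| <= n by nlia.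
have cV' : cyc (V :\ v) by have := no2 v v; rewrite setUid.
have dV := darts_D1 vV.
have sV' : V :\ v \subset V by apply: subsetDl.
have [dv1|dv2] := leqP (deg v V) 1.
  have n2' : no_two_cyc (V :\ v).
    by move=> A B sA sB; apply: n2; apply: subset_trans sV'.
  have no2' x y : cyc (V :\ v :\: [set x; y]).
    apply: contraT => ac.
    have dv' : deg v (V :\ v :\: [set x; y]) <= 1.
      by apply: leq_trans dv1; apply: degS; apply: subset_trans sV'; apply: subsetDl.
    case/negP: (acyc_U1 ac dv').
    by apply: cycS (no2 x y); clear; set_auto.
  have [le [B [sB B0 dB]]] := IHn _ _ leV' n2' cV' no2'; split; first by nlia.
  by exists B; split=> //; apply: subset_trans sB sV'.
have dv' : deg v V = 2 by apply/eqP; rewrite eqn_leq dv.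
have /deg_gt1P[p [q [pV qV pq vp vq]]] := dv2.
have vp' := adj_neq vp; have vq' := adj_neq vq.
have npq : ~~ adj p q.
  (* If p and q were adjacent, the rest after the triangle v, p, q would be a forest. As v has no
     further neighbours, adding v keeps it a forest, so p, q would meet all cycles. *)
  apply/negP=> apq; have cT := triangle_cyc vp apq vq.
  have sT : [set v; p; q] \subset V by rewrite !subUset !sub1set vV pV qV.
  have ac : ~~ cyc (V :\: [set v; p; q]).
    apply: (n2 _ _ sT _ _ cT); first exact: subsetDl.
    by clear; set_auto.
  suff dv0 : deg v (V :\: [set v; p; q]) <= 1.
    case/negP: (acyc_U1 ac dv0); apply: cycS (no2 p q).
    by clear; set_auto.
  have sPQ : [set p; q] \subset V by rewrite subUset !sub1set pV.
  have := degD v sPQ; rewrite dv' degU1 ?inE // {1}/deg big_set1 vp vq.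
  have : deg v (V :\: [set v; p; q]) <= deg v (V :\: [set p; q]).
    by apply: degS; clear; set_auto.
  by nlia.
have n2' := suppress_no_two_cyc vV pq npq vp vq dv' n2.
have no2' x y := suppress_cyc pV qV pq npq vp vq dv' (no2 x y).
have [le [B0 [sB0 B00 dB0]]] := IHn (add_edge p q) (V :\ v) leV' n2' (cyc_addW pq npq cV') no2'.
have [pV' qV'] : p \in V :\ v /\ q \in V :\ v by rewrite !inE !(eq_sym _ v) vp' vq'.
split.
  move: le; rewrite (darts_add (V :\ v) pq npq) pV' qV' -[#|_|]/(#|V :\ v|) => le.
  by nlia.
pose B : {set G} := B0; have sB : B \subset V :\ v by [].
have vB : v \notin B by apply/negP=> /(subsetP sB); rewrite !inE eqxx.
move: dB0; rewrite (darts_add B pq npq) -[#|_|]/(#|B|).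
(* If B contains the new edge, v takes its place: one vertex more, two edges for one, the same
   excess. *)
case: (boolP ((p \in B) && (q \in B))) => [/andP[pB qB]|_] dB; last first.
  by exists B; split=> //; [apply: subset_trans sB sV'|nlia].
exists (v |: B); split.
- by rewrite subUset sub1set vV (subset_trans sB sV').
- by apply/set0Pn; exists v; rewrite setU11.
rewrite cardsU1 vB darts_U1 //.
have : 1 < deg v B by apply/deg_gt1P; exists p, q.
by nlia.
Qed.

(** * Possible edge numbers of a saturated graph *)

Section SaturatedEdges.
Variable G : sgraph.
Hypotheses (satG : sat G) (n6 : 5 < #|G|).
Implicit Types (x y z : G).

Lemma sat_no_fvs2 : (forall x y, x != y -> cyc (~: [set x; y])) ->
  darts [set: G] = 2 * #|G| + 10.
Proof.
move=> no2.
have no2' x y : cyc ([set: G] :\: [set x; y]).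
  rewrite setTD; have [->|] := eqVneq x y; last exact: no2.
  have /card_gt0P[z] : 0 < #|~: [set y]| by have := cardT_C1 y; nlia.
  by rewrite !inE => zy; apply: cycS (no2 _ _ zy); set_auto.
have /card_gt0P[x _] : 0 < #|G| by nlia.
have cT : cyc [set: G] by apply: cycS (no2' x x); apply: subsetT.
have [le [B [_ B0 dB]]] := no_fvs2_edges (leqnn _) (proj1 satG) cT no2'.
have := conn_darts (sat_conn satG) (subsetT B) B0.
by rewrite cardsT in le *; nlia.
Qed.

(** Stated for d = 2m: m = n + 2k, or m in [n + 5, 2n - 2], or the values 10 and 11 for n = 6. *)
Definition edge_spectrum d :=
  [\/ exists2 k, 3 <= k <= #|G| - 3 & d = 2 * #|G| + 4 * k,
      2 * #|G| + 10 <= d /\ d + 4 <= 4 * #|G| |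
      #|G| = 6 /\ (d = 20 \/ d = 22)].

Lemma universal_spectrum x : ~~ cyc (~: [set x]) -> edge_spectrum (darts [set: G]).
Proof. by move=> acx; have [d n8] := universal_edges satG acx n6; apply: Or32; nlia. Qed.

Lemma deg_card x (A : {set G}) : deg x A <= #|A|.
Proof. by rewrite degE; apply: subset_leq_card; apply/subsetP=> y; rewrite inE => /andP[]. Qed.

Lemma unicyclic_spectrum x y : x != y -> ~~ cyc (~: [set x; y]) -> cyc (~: [set x]) ->
  darts (~: [set x]) <= 2 * #|~: [set x]| -> edge_spectrum (darts [set: G]).
Proof.
move=> xy acF cH dH; have [dT] := unicyclic_edges satG xy acF cH dH n6.
have := deg_card x (~: [set x]); have := cardT_C1 x => cT le [d6|[c6 d5]].
  by apply: Or32; nlia.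
by apply: Or33; split=> //; left; nlia.
Qed.

Lemma sat_spectrum : edge_spectrum (darts [set: G]).
Proof.
have [/existsP[x /existsP[y /andP[xy acF]]]|no2] :=
  boolP [exists x : G, exists y : G, (x != y) && ~~ cyc (~: [set x; y])]; last first.
  have dT : darts [set: G] = 2 * #|G| + 10.
    apply: sat_no_fvs2 => x y xy; apply: contraNT no2 => acF.
    by apply/existsP; exists x; apply/existsP; exists y; rewrite xy.
  have [n7|n7] := leqP 7 #|G|; first by apply: Or32; nlia.
  by apply: Or33; split; [|right]; nlia.
have [cx|] := boolP (cyc (~: [set x])); last exact: universal_spectrum.
have [cy|] := boolP (cyc (~: [set y])); last exact: universal_spectrum.
have yx : y != x by rewrite eq_sym.
have acF' : ~~ cyc (~: [set y; x]) by rewrite setUC.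
have [|dx] := leqP (darts (~: [set x])) (2 * #|~: [set x]|).
  exact: (unicyclic_spectrum xy acF cx).
have [|dy] := leqP (darts (~: [set y])) (2 * #|~: [set y]|).
  exact: (unicyclic_spectrum yx acF' cy).
have cF : #|G| = #|~: [set x; y]| + 2.
  by rewrite -(cardsC [set x; y]) cards2 xy addnC.
(* By parity, more than one cycle in G - x means [darts] at least 2|G - x| + 2, which is the bound
   [fvs2_sink] asks for. *)
have := odd_darts (~: [set x]); have := odd_darts (~: [set y]) => oy ox.
have cx1 := cardT_C1 x; have cy1 := cardT_C1 y.
have [] := fvs2_sink (proj1 satG) xy acF; [|..].
- by clear -dy oy cF cy1; lia.
- by clear -dx ox cF cx1; lia.
move=> z [xz yz acxz acyz].
have [dF _ _] := triple_degs satG xy xz yz acF acxz acyz.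
have dT := triple_darts satG xy xz yz acF acxz acyz.
have cT := triple_card xy xz yz.
have n5 : 4 < #|G| by nlia.
have := triple_deg_ge3 satG xy xz yz acF acxz acyz n5.
move: (deg x _) dF dT => k dF dT k3.
by apply: Or31; exists k => //; rewrite k3; nlia.
Qed.

End SaturatedEdges.

(** * Copies of cycles *)

Lemma darts_edges (G : sgraph) : darts [set: G] = 2 * #|edges G|.
Proof.
pose D := [set p : G * G | adj p.1 p.2]; pose f (p : G * G) := [set p.1; p.2].
have -> : darts [set: G] = \sum_(p in D) 1.
  rewrite /darts /arcs /deg pair_big big_mkcond [RHS]big_mkcond /=.
  by apply: eq_bigr => -[x y] _; rewrite !inE /=; case: (adj x y).
rewrite (partition_big_imset f) mulnC -sum_nat_const /=.
have -> : edges G = f @: D.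
  by apply/setP=> E; apply/imsetP/imsetP=> -[p pD ->]; exists p; move: pD; rewrite !inE.
apply: eq_bigr => E /imsetP[[x y]]; rewrite inE /= => xy ->{E}.
have xy' := adj_neq xy; have yx' : y != x by rewrite eq_sym.
rewrite sum1dep_card -[RHS](_ : #|[set (x, y); (y, x)]| = 2); last first.
  by rewrite cards2 xpair_eqE (negPf xy').
apply: eq_card => -[u v]; rewrite !inE /f /= !xpair_eqE; apply/andP/orP.
  case=> uv /eqP/setP E; have := E u; have := E v; have uv' := adj_neq uv.
  rewrite !inE !eqxx orbT /= => /esym vxy /esym uxy; move: uv'.
  case/orP: vxy => /eqP->; case/orP: uxy => /eqP->; rewrite ?eqxx // => _.
    by right.
  by left.
case=> /andP[/eqP-> /eqP->]; split=> //; first by rewrite adj_sym.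
by rewrite setUC.
Qed.

Section OrdS.
Variable l : nat.
Implicit Type j : 'I_l.

Lemma val_ordS j : ordS j = (if j.+1 < l then j.+1 else 0) :> nat.
Proof.
rewrite /=; case: ltnP => jl; first by rewrite modn_small.
by have -> : j.+1 = l; [apply/eqP; rewrite eqn_leq ltn_ord|rewrite modnn].
Qed.

Lemma ordS_neq j : 1 < l -> j != ordS j.
Proof.
move=> l1; apply/eqP=> /(congr1 (@nat_of_ord l)); rewrite val_ordS.
by case: ifP; have := ltn_ord j; lia.
Qed.

Lemma ordSS_neq j : 2 < l -> j != ordS (ordS j).
Proof.
move=> l2; apply/eqP=> /(congr1 (@nat_of_ord l)); rewrite !val_ordS.
by have := ltn_ord j; do 2 case: ifP; lia.
Qed.

Lemma cycle_adjS j : 1 < l -> cycle_adj j (ordS j).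
Proof. by move=> l1; rewrite /cycle_adj ordS_neq // eqxx. Qed.
End OrdS.

Section Copies.
Variable G : sgraph.
Implicit Types (A B C : {set G}) (x y z : G) (s p : seq G).

(** In the image of each cycle the successor and the predecessor are two distinct neighbours because
    the length is at least 3, so [cyc_core] applies. *)
Lemma contains_member_cyc : contains_member (cycles_ge3 2) G ->
  exists A B, [/\ [disjoint A & B], cyc A & cyc B].
Proof.
case=> H [l l3 [g [g' gK g'K] gadj]] [f finj fadj].
pose D := dunion (fun i => cycle_graph (l i)); pose h (d : D) := f (g' d).
have hinj : injective h by move=> d d' /finj /(can_inj g'K).
have hadj (d d' : D) : adj d d' -> adj (h d) (h d').
  by move=> dd'; apply: fadj; rewrite -gadj !g'K.
pose A i := [set h (Tagged (fun i => 'I_(l i)) j) | j : 'I_(l i)].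
have cA i : cyc (A i).
  have l1 : 1 < l i by apply: leq_trans (l3 i).
  have j0 : 'I_(l i) by apply: (Ordinal (ltnW l1)).
  apply: (cyc_core (subxx _)).
    by apply/set0Pn; exists (h (Tagged (fun i => 'I_(l i)) j0)); apply: imset_f.
  move=> _ /imsetP[j _ ->]; apply/deg_gt1P.
  pose k := ord_pred j; have jE : j = ordS k by rewrite ord_predK.
  exists (h (Tagged (fun i => 'I_(l i)) (ordS j))), (h (Tagged (fun i => 'I_(l i)) k)).
  split; try exact: imset_f.
  - rewrite (inj_eq hinj) eq_sym /eq_op /= /tag_eq /= eqxx tagged_asE jE /=.
    by apply: ordSS_neq.
  - by apply: hadj; rewrite /= /dunion_adj /= eqxx tagged_asE cycle_adjS.
  - rewrite adj_sym; apply: hadj; rewrite /= /dunion_adj /= eqxx tagged_asE.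
    by rewrite jE cycle_adjS.
exists (A ord0), (A ord_max); split=> //.
rewrite disjoint_subset; apply/subsetP=> _ /imsetP[j _ ->]; rewrite inE.
by apply/negP=> /imsetP[j' _ /hinj/(congr1 (@tag _ _))].
Qed.

(** The path grows at its head x, n bounding the room left in C. Once stuck, all neighbours of x in
    C lie on the path; one of them, z, is not the second vertex, and the part from x to z closes
    up. *)
Lemma core_closed_path C : (forall v, v \in C -> 2 <= deg v C) ->
  forall n x p, #|C| <= n + size p -> path (@adj G) x p -> uniq (x :: p) ->
  {subset x :: p <= C} ->
  exists s, [/\ uniq s, 2 < size s, cycle (@adj G) s & {subset s <= C}].
Proof.
move=> coreC; elim=> [|n IHn] x p len pp up sC.
  have : size (x :: p) <= size (enum C).
    by apply: uniq_leq_size => // z zp; rewrite mem_enum sC.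
  by rewrite -cardE /= => lt; move: len; rewrite add0n leqNgt lt.
have xC : x \in C by apply: sC; rewrite inE eqxx.
have [/exists_inP[w wC /andP[xw wp]]|/exists_inPn closed] :=
    boolP [exists w in C, adj x w && (w \notin x :: p)].
  apply: (IHn w (x :: p)); rewrite /= ?addnS // ?wp //; first by rewrite adj_sym xw.
  by move=> z; rewrite inE => /predU1P[->|/sC].
have inp w : w \in C -> adj x w -> w \in p.
  move=> wC xw; have := closed w wC; rewrite xw /= negbK inE => /predU1P[wx|//].
  by move: xw; rewrite wx adj_irr.
have /deg_gt1P[u [w [uC wC uw xu xw]]] := coreC x xC.
case: p pp up sC inp {len IHn closed} => [|y p] /= pp up sC inp; first by have := inp u uC xu.
have [z [zy zp xz]] : exists z, [/\ z != y, z \in p & adj x z].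
  have := inp u uC xu; have := inp w wC xw; rewrite !inE.
  have [uy|uy] := eqVneq u y => /=; last by exists u.
  have [wy|wy] := eqVneq w y => /=; last by exists w.
  by move: uw; rewrite uy wy eqxx.
clear inp; case/splitPr: p / zp pp up sC => p1 p2 pp up sC.
exists (x :: y :: rcons p1 z); split.
- move: up; rewrite -cat_rcons -!cat_cons.
  change (uniq ((x :: y :: rcons p1 z) ++ p2) -> uniq (x :: y :: rcons p1 z)).
  by rewrite cat_uniq => /andP[].
- by rewrite /= size_rcons.
- rewrite /= rcons_path last_rcons (adj_sym z) xz andbT.
  by move: pp; rewrite -cat_rcons cat_path => /and3P[-> ->].
- move=> t ts; apply: sC; rewrite -cat_rcons -!cat_cons mem_cat.
  by rewrite -!rcons_cons in ts *; rewrite ts.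
Qed.

Lemma cyc_closed_path A : cyc A ->
  exists s, [/\ uniq s, 2 < size s, cycle (@adj G) s & {subset s <= A}].
Proof.
case/mincyc_exists=> C sCA mC; case/set0Pn: (mincyc_neq0 mC) => x xC.
have [|//|//|z|s [us s3 cs sC]] := core_closed_path (mincyc_deg_le mC) (n := #|C|) (x := x) (p := [::]).
- by rewrite addn0.
- by rewrite inE => /eqP->.
by exists s; split=> // z /sC; apply: (subsetP sCA).
Qed.

Lemma cycle_nth x0 s j : cycle (@adj G) s -> j < size s ->
  adj (nth x0 s j) (nth x0 s (if j.+1 < size s then j.+1 else 0)).
Proof.
case: s => // x p cp jl; have := pathP x0 cp j; rewrite size_rcons => /(_ jl).
rewrite -rcons_cons !nth_rcons jl [j.+1 < _]ltnS; case: ltnP => // jp.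
have -> : j = size p by apply/eqP; rewrite eqn_leq jp -ltnS jl.
by rewrite eqxx.
Qed.

Lemma cyc_contains_member A B : [disjoint A & B] -> cyc A -> cyc B ->
  contains_member (cycles_ge3 2) G.
Proof.
move=> dAB /cyc_closed_path[sA [uA lA cA subA]] /cyc_closed_path[sB [uB lB cB subB]].
pose s (i : 'I_2) := if i == ord0 then sA else sB.
have us i : uniq (s i) by rewrite /s; case: ifP.
have ls i : 2 < size (s i) by rewrite /s; case: ifP.
have cs i : cycle (@adj G) (s i) by rewrite /s; case: ifP.
(* [x0] is only the default of [nth]; all indices used are in range. *)
have x0 : G by case: sA lA {uA cA subA s us ls cs}.
exists (dunion (fun i => cycle_graph (size (s i)))).
  exists (fun i => size (s i)) => //; exists id => //; exact: (Bijective (g := id)).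
exists (fun t : {i : 'I_2 & 'I_(size (s i))} => nth x0 (s (tag t)) (nat_of_ord (tagged t))).
  have one (k : 'I_2) : k <> ord0 -> k = ord_max.
    by case: k => [[|[|//]] kl] nk; [case: nk|]; apply: val_inj.
  have disj (i i' : 'I_2) x : x \in s i -> x \in s i' -> i = i'.
    rewrite /s; case: eqP => [->|ni]; case: eqP => [->|ni'] //.
    - by move=> /subA xA /subB; rewrite (disjointFr dAB xA).
    - by move=> /subB xB /subA xA; move: xB; rewrite (disjointFr dAB xA).
    by move=> _ _; rewrite (one i ni) (one i' ni').
  move=> [i j] [i' j'] /= E; have ii' : i = i'.
    by apply: (disj _ _ (nth x0 (s i) j)); [|rewrite E]; apply: mem_nth; apply: ltn_ord.
  subst i'; congr (Tagged _ _); apply: val_inj => /=.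
  by move/eqP: E; rewrite nth_uniq // => /eqP.
move=> [i j] [i' j'] /=; rewrite /dunion_adj /= => /andP[/eqP ii']; subst i'.
rewrite tagged_asE /= => /andP[_ /orP[] /eqP->].
  by rewrite val_ordS; apply: cycle_nth.
by rewrite adj_sym val_ordS; apply: cycle_nth.
Qed.

Lemma contains_memberP : contains_member (cycles_ge3 2) G <-> ~ no_two_cyc [set: G].
Proof.
split=> [/contains_member_cyc[A [B [dAB cA cB]]] n2|/not_no_two_cyc[A [B [_ _ dAB cA cB]]]].
  by have := n2 _ _ (subsetT _) (subsetT _) dAB cA; rewrite cB.
exact: cyc_contains_member dAB cA cB.
Qed.

End Copies.

Lemma saturatedP (G : sgraph) : saturated (cycles_ge3 2) G <-> sat G.
Proof.
split=> [[nc ad]|[n2 ad]]; split.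
- apply: no_two_cycP => -[A [B [_ _ dAB cA cB]]].
  by apply: nc; apply: cyc_contains_member cA cB.
- by move=> u v uv nuv; apply/contains_memberP; apply: ad.
- by move/contains_memberP.
- by move=> u v uv nuv; apply/contains_memberP; apply: ad.
Qed.

(** * Constructions *)

Section Ranks.
Variable G : sgraph.
Implicit Types (A C W : {set G}) (u v x : G).

(** On a cycle, a vertex of largest rank would have two distinct neighbours of no larger rank. *)
Lemma acyc_rank A (rank : G -> nat) :
  (forall v u w, v \in A -> u \in A -> w \in A -> adj v u -> adj v w ->
    rank u <= rank v -> rank w <= rank v -> u = w) -> ~~ cyc A.
Proof.
move=> rankP; apply/negP=> /mincyc_exists[C sCA mC].
case/set0Pn: (mincyc_neq0 mC) => x xC.
case: (arg_maxnP rank xC) => v vC maxv.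
have /deg_gt1P[u [w [uC wC uw vu vw]]] := mincyc_deg_le mC vC.
case/eqP: uw; apply: (rankP v); rewrite ?(subsetP sCA) //; exact: maxv.
Qed.

(** Descending ranks lead from every vertex to x, so a vertex of least rank outside the component of
    x cannot exist. *)
Lemma tight_rank A x (rank : G -> nat) : x \in A ->
  (forall v, v \in A -> v != x -> exists u, [/\ u \in A, adj v u & rank u < rank v]) -> tight A.
Proof.
move=> xA rankP; have [W [xW sWA tW a0]] := component xA.
suff <- : W = A by [].
apply/eqP; rewrite eqEsubset sWA -setD_eq0; apply: contraT => /set0Pn[y yAW].
case: (arg_minnP rank yAW) => v /setDP[vA vW] minv.
have vx : v != x by apply: contraNneq vW => ->.
have [u [uA vu lt_uv]] := rankP v vA vx.
have [uW|uW] := boolP (u \in W).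
  by have := arcs_eq0 a0 uW (y := v); rewrite inE vW vA adj_sym vu => /(_ isT).
have /minv : u \in A :\: W by rewrite inE uW.
by rewrite leqNgt lt_uv.
Qed.

End Ranks.

Section OrdGraph.
Variables (n : nat) (r : rel nat).

(** Only the values [r i j] with i < j matter, so a construction just lists the earlier neighbours
    of each j. *)
Definition upper_adj : rel nat := fun i j => (i < j) && r i j || (j < i) && r j i.
Definition ord_adj : rel 'I_n := fun i j => upper_adj i j.

Fact ord_adj_sym : symmetric ord_adj.
Proof. by move=> i j; rewrite /ord_adj /upper_adj orbC. Qed.

Fact ord_adj_irr : irreflexive ord_adj.
Proof. by move=> i; rewrite /ord_adj /upper_adj ltnn. Qed.

Definition ord_graph := SGraph ord_adj_sym ord_adj_irr.
Definition ord_set (P : pred nat) : {set ord_graph} := [set i : 'I_n | P i].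

Lemma card_ord_graph : #|ord_graph| = n.
Proof. exact: card_ord. Qed.

Lemma darts_ord_graph :
  darts [set: ord_graph] = 2 * \sum_(0 <= j < n) \sum_(0 <= i < j) r i j.
Proof.
have -> : darts [set: ord_graph] =
    \sum_(i < n) \sum_(j < n) ((i < j) && r i j) + \sum_(i < n) \sum_(j < n) ((j < i) && r j i).
  rewrite /darts /arcs /deg -big_split; apply: eq_big => [i|i _]; first by rewrite inE.
  rewrite -big_split; apply: eq_big => [j|j _]; first by rewrite inE.
  by rewrite /= /ord_adj /upper_adj; case: ltngtP; rewrite //= ?orbF ?addn0.
rewrite [X in X + _]exchange_big /= addnn -mul2n; congr (2 * _).
rewrite big_mkord; apply: eq_bigr => j _.
rewrite (big_nat_widen _ _ n) ?(ltnW (ltn_ord j)) // big_mkord [RHS]big_mkcond.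
by apply: eq_bigr => i _; case: ltnP.
Qed.

Lemma ord_acyc (P : pred nat) (rank : nat -> nat) :
  (forall v u w, v < n -> u < n -> w < n -> P v -> P u -> P w ->
    upper_adj v u -> upper_adj v w -> rank u <= rank v -> rank w <= rank v -> u = w) ->
  ~~ cyc (ord_set P).
Proof.
move=> rankP; apply: (@acyc_rank _ _ (fun i : ord_graph => rank (nat_of_ord i))) => v u w.
rewrite !inE => Pv Pu Pw vu vw lu lw; apply: val_inj.
by apply: (rankP v); rewrite ?ltn_ord.
Qed.

Lemma ord_tight (P : pred nat) x (rank : nat -> nat) : x < n -> P x ->
  (forall v, v < n -> P v -> v != x ->
    exists u, [/\ u < n, P u, upper_adj v u & rank u < rank v]) -> tight (ord_set P).
Proof.
move=> xn Px rankP.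
apply: (@tight_rank ord_graph _ (Ordinal xn) (fun i : ord_graph => rank (nat_of_ord i))) => [|v].
  by rewrite inE.
rewrite inE => Pv; rewrite -val_eqE /= => vx.
by have [u [un Pu vu ru]] := rankP v (ltn_ord v) Pv vx; exists (Ordinal un); rewrite inE.
Qed.

Lemma ord_cyc (P : pred nat) x : x < n -> P x ->
  (forall v, v < n -> P v ->
    exists u w, [/\ u < n, w < n, P u & P w] /\ [/\ u != w, upper_adj v u & upper_adj v w]) ->
  cyc (ord_set P).
Proof.
move=> xn Px nbrP; apply: (cyc_core (subxx _)).
  by apply/set0Pn; exists (Ordinal xn); rewrite inE.
move=> v; rewrite inE => Pv; apply/deg_gt1P.
have [u [w [[un wn Pu Pw] [uw vu vw]]]] := nbrP v (ltn_ord v) Pv.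
by exists (Ordinal un), (Ordinal wn); rewrite !inE -val_eqE.
Qed.

Lemma ord_triangle a b c : a < b < c -> c < n -> r a b -> r b c -> r a c ->
  cyc (ord_set [in [:: a; b; c]]).
Proof.
move=> /andP[ab bc] cn rab rbc rac; have an : a < n by lia.
have ac : a < c := ltn_trans ab bc.
have bn : b < n by lia.
have adjs : [/\ upper_adj a b, upper_adj b c, upper_adj a c & True].
  by rewrite /upper_adj ab bc ac rab rbc rac.
have adjs' : [/\ upper_adj b a, upper_adj c b & upper_adj c a].
  by rewrite /upper_adj ab bc ac rab rbc rac !orbT.
case: adjs adjs' => ? ? ? _ [? ? ?].
have ba : b != a by rewrite gtn_eqF.
have ca : c != a by rewrite gtn_eqF.
have cb : c != b by rewrite gtn_eqF.
apply: (@ord_cyc _ a) => // [|v vn]; first by rewrite !inE eqxx.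
rewrite !inE => /or3P[] /eqP->; [exists c, b|exists c, a|exists b, a];
  by rewrite !inE !eqxx ?orbT.
Qed.

Lemma ord_sat : no_two_cyc [set: ord_graph] ->
  (forall i j, i < j -> j < n -> ~~ r i j -> exists P Q : pred nat,
    [/\ P i, P j, forall k, P k -> ~~ Q k, tight (ord_set P) & cyc (ord_set Q)]) ->
  sat ord_graph.
Proof.
move=> n2 nonadj; split=> // u v uv nuv.
have [P [Q [Pu Pv PQ tP cQ]]] : exists P Q : pred nat,
    [/\ P u, P v, forall k, P k -> ~~ Q k, tight (ord_set P) & cyc (ord_set Q)].
  move: uv nuv; rewrite -val_eqE /= /ord_adj /upper_adj.
  case: ltngtP => // [uv|vu] _; rewrite /= ?orbF => nr; first exact: nonadj.
  by have [P [Q [? ? ? ? ?]]] := nonadj _ _ vu (ltn_ord u) nr; exists P, Q.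
apply: (not_no_two_cyc_add uv nuv _ _ tP cQ); rewrite ?inE //.
by rewrite disjoint_subset; apply/subsetP=> k; rewrite !inE; apply: PQ.
Qed.

End OrdGraph.

Section JoinedTriangle.
Variables n t : nat.
Hypotheses (t3 : 3 <= t) (tn : t <= n - 3).

(* 0, 1, 2 form a triangle, each of 3, ..., t + 2 is joined to all three, and the remaining
   vertices are pendant at 3. *)
Let r i j := [|| j < 3, (i < 3) && (j < t + 3) | (i == 3) && (t + 3 <= j)].

Lemma joined_triangle_sum : \sum_(0 <= j < n) \sum_(0 <= i < j) r i j = n + 2 * t.
Proof.
rewrite (@big_cat_nat _ _ _ 3) //=; last by lia.
rewrite (@big_cat_nat _ _ _ (t + 3) 3 n) /=; try lia.
have -> : \sum_(0 <= j < 3) \sum_(0 <= i < j) r i j = 3.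
  by rewrite !big_nat_recr //= !big_geq //.
rewrite (eq_big_nat _ _ (F2 := fun => 3)) => [|j /andP[j3 jt]]; last first.
  rewrite (@big_cat_nat _ _ _ 3) //= big_nat_recr //= big_nat_recr //= big_nat1.
  rewrite (eq_big_nat _ _ (F2 := fun => 0)) ?sum_nat_const_nat.
    by rewrite /r /= jt; case: (j < 3); lia.
  by move=> i /andP[i3 ij]; rewrite /r; lia.
rewrite (eq_big_nat (m := t + 3) _ _ (F2 := fun => 1)) => [|j /andP[jt jn]]; last first.
  rewrite (@big_cat_nat _ _ _ 3) //=; last by lia.
  rewrite (big_ltn (m := 3)) //=; last by lia.
  rewrite (eq_big_nat _ _ (F2 := fun => 0)) => [|i /andP[i0 i3]]; last by rewrite /r; lia.
  rewrite (eq_big_nat (m := 4) _ _ (F2 := fun => 0)) => [|i /andP[i3 ij]]; last by rewrite /r; lia.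
  by rewrite !sum_nat_const_nat /r; lia.
by rewrite !sum_nat_const_nat; lia.
Qed.

(** Any two of 0, 1, 2 meet all cycles, so each cycle contains two of the three and no two cycles
    are disjoint. For a non-edge, a short tree through its ends is paired with a disjoint
    triangle. *)
Lemma joined_triangle_sat : sat (ord_graph n r).
Proof.
have ac a b : a < b < 3 -> ~~ cyc (ord_set n r (fun k => (k != a) && (k != b))).
  by move=> ab; apply: (@ord_acyc _ _ _ id) => v u w _ _ _; rewrite /upper_adj /r; lia.
apply: ord_sat => [|i j ij jn].
  apply: no_two_cycP => -[A [B [_ _ dAB cA cB]]].
  have n0 : 0 < n by lia.
  have n1 : 1 < n by lia.
  have n2 : 2 < n by lia.
  have two (D : {set ord_graph n r}) : cyc D -> [/\ (Ordinal n0 \in D) || (Ordinal n1 \in D),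
      (Ordinal n0 \in D) || (Ordinal n2 \in D) & (Ordinal n1 \in D) || (Ordinal n2 \in D)].
    move=> cD; have key a b (an : a < n) (bn : b < n) : a < b < 3 ->
        (Ordinal an \in D) || (Ordinal bn \in D).
      move=> ab; apply: contraT; rewrite negb_or => /andP[aD bD].
      case/negP: (ac _ _ ab); apply: cycS cD; apply/subsetP=> k kD; rewrite inE.
      apply/andP; split.
        apply: contraNneq aD => kE; rewrite (_ : Ordinal an = k :> 'I_n) //; exact: val_inj.
      apply: contraNneq bD => kE; rewrite (_ : Ordinal bn = k :> 'I_n) //; exact: val_inj.
    by split; apply: key.
  have [a1 a2 a3] := two A cA; have [b1 b2 b3] := two B cB.
  have dis k : ~~ ((k \in A) && (k \in B)).
    by apply/negP=> /andP[kA]; rewrite (disjointFr dAB kA).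
  move: (dis (Ordinal n0)) (dis (Ordinal n1)) (dis (Ordinal n2)) a1 a2 a3 b1 b2 b3.
  by do 6 case: (_ \in _).
(* As t is at least 3, the vertices 3, 4, 5 are all joined to the triangle, and one of them differs
   from i and j. *)
have [x xij] : exists x, [&& 3 <= x <= 5, x != i & x != j].
  exists (if (i != 3) && (j != 3) then 3 else if (i != 4) && (j != 4) then 4 else 5).
  by case: (i =P 3) => ?; case: (j =P 3) => ?; case: (i =P 4) => ?; case: (j =P 4) => ? /=; lia.
have [i3|i3] := ltnP i 3.
  pose Q := [:: if i == 0 then 1 else 0; if i == 2 then 1 else 2; 4].
  move=> nr; have jt : t + 3 <= j by move: nr; rewrite /r; lia.
  exists [in [:: i; 3; j]], [in Q]; split; rewrite ?inE ?eqxx ?orbT //.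
  - by move=> k; rewrite /Q !inE; case: (i =P 0) => ?; case: (i =P 2) => ?; lia.
  - apply: (@ord_tight _ _ _ 3 (fun k => k != 3)); rewrite ?inE ?eqxx ?orbT //; first by lia.
    move=> v vn; rewrite !inE => vP v3; exists 3; rewrite !inE eqxx orbT v3.
    by split; rewrite // /upper_adj /r; lia.
  - by apply: ord_triangle; rewrite /Q /r; case: (i =P 0) => ?; case: (i =P 2) => ?; lia.
move=> nr; have [jt|jt] := ltnP j (t + 3).
  exists [in [:: i; 0; j]], [in [:: 1; 2; x]]; split; rewrite ?inE ?eqxx ?orbT //.
  - by move=> k; rewrite !inE; lia.
  - apply: (@ord_tight _ _ _ 0 id); rewrite ?inE ?eqxx ?orbT //; first by lia.
    move=> v vn; rewrite !inE => vP v0; exists 0; rewrite !inE eqxx orbT.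
    by split; rewrite // /upper_adj /r; lia.
  - by apply: ord_triangle; rewrite /r; lia.
have [it|it] := ltnP i (t + 3).
  exists [in [:: i; 0; 3; j]], [in [:: 1; 2; if i == 4 then 5 else 4]]; split;
    rewrite ?inE ?eqxx ?orbT //.
  - by move=> k; rewrite !inE; case: (i =P 4) => ?; lia.
  - apply: (@ord_tight _ _ _ 0 id); rewrite ?inE ?eqxx ?orbT //; first by lia.
    move=> v vn; rewrite !inE => vP v0; have [vj|vj] := eqVneq v j.
      by exists 3; rewrite !inE eqxx !orbT; split; rewrite // /upper_adj /r; lia.
    by exists 0; rewrite !inE eqxx !orbT; split; rewrite // /upper_adj /r; lia.
  - by apply: ord_triangle; rewrite /r; case: (i =P 4) => ?; lia.
exists [in [:: i; 3; j]], [in [:: 0; 1; 2]]; split; rewrite ?inE ?eqxx ?orbT //.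
- by move=> k; rewrite !inE; lia.
- apply: (@ord_tight _ _ _ 3 id); rewrite ?inE ?eqxx ?orbT //; first by lia.
  move=> v vn; rewrite !inE => vP v3; exists 3; rewrite !inE eqxx orbT.
  by split; rewrite // /upper_adj /r; lia.
- by apply: ord_triangle; rewrite /r; lia.
Qed.

End JoinedTriangle.

Lemma sum_nat_eq a m : \sum_(0 <= i < m) nat_of_bool (i == a) = (a < m).
Proof. by elim: m => [|m IHm]; [rewrite big_geq|rewrite big_nat_recr //= IHm; lia]. Qed.

Section PendantWheel.
Variables n l : nat.
Hypotheses (l5 : 5 <= l) (ln : l < n).

(* A wheel with rim 0, ..., l - 1 and hub l; the vertex l + 1, if any, is joined to 0 and to the
   hub, and the remaining vertices are pendant at l + 1. *)
Let r i j := [|| (j < l) && ((j == i.+1) || (i == 0) && (j.+1 == l)), j == l,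
  (j == l.+1) && ((i == 0) || (i == l)) | (l.+1 < j) && (i == l.+1)].

(** The plain wheel, n = l + 1, serves n = 6 with 10 edges; otherwise l can be any number from 5 to
    n - 2. *)
Lemma pendant_wheel_sum :
  \sum_(0 <= j < n) \sum_(0 <= i < j) r i j = if n == l.+1 then 2 * l else n + l.
Proof.
have two j a b : a < b < j -> (forall i, i < j -> r i j = (i == a) || (i == b)) ->
    \sum_(0 <= i < j) r i j = 2.
  move=> ab rE; transitivity (\sum_(0 <= i < j) ((i == a) + (i == b))).
    by apply: eq_big_nat => i /andP[_ ij]; rewrite rE //; lia.
  by rewrite big_split /= !sum_nat_eq; lia.
have one j a : a < j -> (forall i, i < j -> r i j = (i == a)) ->
    \sum_(0 <= i < j) r i j = 1.
  move=> aj rE; transitivity (\sum_(0 <= i < j) nat_of_bool (i == a)).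
    by apply: eq_big_nat => i /andP[_ ij]; rewrite rE.
  by rewrite sum_nat_eq aj.
have rim : \sum_(0 <= j < l) \sum_(0 <= i < j) r i j = l.
  have -> : l = (l - 2).+2 by lia.
  rewrite big_nat_recr //= big_ltn // big_geq // add0n.
  rewrite (two _ 0 (l - 2)); [|lia|by move=> i il; rewrite /r; lia].
  rewrite (eq_big_nat _ _ (F2 := fun => 1)) ?sum_nat_const_nat; first by lia.
  by move=> j jl; apply: (one _ (j - 1)) => [|i ij]; rewrite ?/r; lia.
have hub : \sum_(0 <= i < l) r i l = l.
  rewrite (eq_big_nat _ _ (F2 := fun => 1)) ?sum_nat_const_nat; first by lia.
  by move=> j jl; rewrite /r; lia.
rewrite (@big_cat_nat _ _ _ l.+1) //= big_nat_recr //= rim hub.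
case: eqP => nl; first by rewrite big_geq; lia.
rewrite big_ltn; last by lia.
rewrite (two _ 0 l); [|lia|by move=> i il; rewrite /r; lia].
rewrite (eq_big_nat _ _ (F2 := fun => 1)) ?sum_nat_const_nat; first by lia.
by move=> j jl; apply: (one _ l.+1) => [|i ij]; rewrite ?/r; lia.
Qed.

(** A cycle missing the hub contains the whole rim, and without the rim there is no cycle. For most
    non-edges the disjoint cycle is a triangle of the hub and a rim edge whose removal leaves a
    connected graph. *)
Lemma pendant_wheel_sat : sat (ord_graph n r).
Proof.
have ac_hub t : t < l -> ~~ cyc (ord_set n r (fun k => (k != l) && (k != t))).
  move=> tl.
  (* Removing t cuts the rim into a path from t + 1 round to t - 1; ranks follow this path, and the
     outer vertices come last. *)
  apply: (@ord_acyc _ _ _ (fun v => if v < t then v + l else if v < l then v else v + 2 * l)).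
  move=> v u w _ _ _; rewrite /upper_adj /r.
  case: (ltnP v t) => vt; case: (ltnP u t) => ut; case: (ltnP w t) => wt;
    case: (ltnP v l) => vl; case: (ltnP u l) => ul; case: (ltnP w l) => wl; lia.
have ac_rim : ~~ cyc (ord_set n r (fun k => l <= k)).
  by apply: (@ord_acyc _ _ _ id) => v u w _ _ _; rewrite /upper_adj /r; lia.
apply: ord_sat => [|i j ij jn].
  pose hub : ord_graph n r := Ordinal ln.
  have rim (D : {set ord_graph n r}) (k : ord_graph n r) :
      cyc D -> hub \notin D -> (k : 'I_n) < l -> k \in D.
    move=> cD hD kl; apply: contraT => kD; case/negP: (ac_hub _ kl); apply: cycS cD.
    apply/subsetP=> u uD; rewrite inE; apply/andP; split.
      by apply: contraNneq hD => ul; rewrite (_ : hub = u) //; apply: val_inj.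
    by apply: contraNneq kD => uk; rewrite (_ : k = u) //; apply: val_inj.
  apply: no_two_cycP.
  have key (A B : {set ord_graph n r}) :
      [disjoint A & B] -> cyc A -> cyc B -> hub \notin B -> False.
    move=> dAB cA cB hB; case/negP: ac_rim; apply: cycS cA; apply/subsetP=> u uA.
    by rewrite inE leqNgt; apply/negP=> ul; have := rim B u cB hB ul; rewrite (disjointFr dAB uA).
  move=> [A [B [_ _ dAB cA cB]]]; have [hB|hB] := boolP (hub \in B); last exact: key dAB cA cB hB.
  by apply: (key B A) => //; [rewrite disjoint_sym|rewrite (disjointFl dAB hB)].
(* Vertices before k descend to 0, those after k + 1 go up to l - 1 and from there to 0; k > 0 keeps
   the root 0. *)
have big k : 0 < k -> k.+1 < l ->
    tight (ord_set n r (fun v => (v != l) && (v \notin [:: k; k.+1; l]))).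
  move=> k0 kl.
  apply: (@ord_tight _ _ _ 0 (fun v => if v < k then v else if v < l then l - v else v)).
  - by lia.
  - by rewrite !inE; lia.
  move=> v vn; rewrite !inE => vP v0.
  have [vk|kv] := ltnP v k.
    by exists v.-1; rewrite !inE /upper_adj /r; (have -> : v.-1 < k by lia); split; lia.
  have [vl|lv] := ltnP v l.
    have [vl'|lv'] := eqVneq v.+1 l.
      by exists 0; rewrite !inE /upper_adj /r k0; split; lia.
    exists v.+1; rewrite !inE /upper_adj /r.
    have -> : (v.+1 < k) = false by lia.
    by (have -> : v.+1 < l by lia); split; lia.
  have [vl|lv'] := eqVneq v l.+1.
    by exists 0; rewrite !inE /upper_adj /r k0; split; lia.
  exists l.+1; rewrite !inE /upper_adj /r.
  have -> : (l.+1 < k) = false by lia.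
  by (have -> : (l.+1 < l) = false by lia); split; lia.
have interval a b : a <= b < l -> tight (ord_set n r (fun v => a <= v <= b)).
  move=> ab; apply: (@ord_tight _ _ _ a id); [lia|lia|].
  by move=> v vn vP va; exists v.-1; rewrite /upper_adj /r; split; lia.
have triangle k : k.+1 < l -> cyc (ord_set n r [in [:: k; k.+1; l]]).
  by move=> kl; apply: ord_triangle; rewrite /r; lia.
have use_big k : 0 < k -> k.+1 < l -> i != l -> j != l -> i \notin [:: k; k.+1] ->
    j \notin [:: k; k.+1] -> exists P Q : pred nat,
    [/\ P i, P j, forall k, P k -> ~~ Q k, tight (ord_set n r P) & cyc (ord_set n r Q)].
  move=> k0 kl il jl ik jk.
  exists (fun v => (v != l) && (v \notin [:: k; k.+1; l])), [in [:: k; k.+1; l]].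
  split; [| | |exact: big|exact: triangle].
  - by move: ik; rewrite !inE il; lia.
  - by move: jk; rewrite !inE jl; lia.
  - by move=> v /andP[].
move=> nr; have [jl|lj] := ltnP j l.
  have [far|near] := ltnP i.+2 j.
    by apply: (use_big i.+1); rewrite ?inE; lia.
  have jE : j = i.+2 by move: nr; rewrite /r; lia.
  (* For the pair 0, 2 the triangle uses the rim edge from 3 to 4, so l must be at least 5. *)
  have [i0|i0] := eqVneq i 0; first by apply: (use_big 3); rewrite ?inE; lia.
  have [jl'|jl'] := eqVneq j.+1 l.
    exists (fun v => 2 <= v <= l.-1), [in [:: 0; 1; l]]; split; [lia|lia| | |].
    - by move=> v; rewrite !inE; lia.
    - by apply: interval; lia.
    - by apply: triangle; lia.
  exists (fun v => 1 <= v <= l - 2), [in [:: 0; l.-1; l]]; split; [lia|lia| | |].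
  - by move=> v; rewrite !inE; lia.
  - by apply: interval; lia.
  - by apply: ord_triangle; rewrite /r; lia.
have jl : j != l by move: nr; rewrite /r; lia.
(* Only for the hub and a pendant vertex is the disjoint cycle the rim itself. *)
have [il|il] := eqVneq i l.
  exists [in [:: l; l.+1; j]], (fun v => v < l); split; rewrite ?inE ?il ?eqxx ?orbT //.
  - by move=> v; rewrite !inE; lia.
  - apply: (@ord_tight _ _ _ l id); rewrite ?inE ?eqxx //.
    move=> v vn; rewrite !inE => vP vl; have [vl'|vl'] := eqVneq v l.+1.
      by exists l; rewrite !inE eqxx /upper_adj /r; split; lia.
    by exists l.+1; rewrite !inE eqxx orbT /upper_adj /r; split; lia.
  - apply: (@ord_cyc _ _ _ 0); [lia|lia|] => v vn vl.
    have [v0|v0] := eqVneq v 0; first by exists 1, l.-1; rewrite /upper_adj /r; do 2 split; lia.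
    have [vl'|vl'] := eqVneq v.+1 l.
      by exists 0, v.-1; rewrite /upper_adj /r; do 2 split; lia.
    by exists v.-1, v.+1; rewrite /upper_adj /r; do 2 split; lia.
have [i2|i2] := leqP i 2; first by apply: (use_big 3); rewrite ?inE; lia.
by apply: (use_big 1); rewrite ?inE; lia.
Qed.

End PendantWheel.

Section PendantK5.
Let r i j := (j < 5) || (i == 0).

Lemma pendant_K5_sum : \sum_(0 <= j < 6) \sum_(0 <= i < j) r i j = 11.
Proof. by rewrite !big_nat_recr //= !big_geq. Qed.

(** The pendant vertex is on no cycle, and K5 is too small for two disjoint ones. Joining i to the
    pendant vertex closes a triangle with 0, and the other three vertices of K5 form the second
    one. *)
Lemma pendant_K5_sat : sat (ord_graph 6 r).
Proof.
apply: ord_sat => [|i j ij j6].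
  pose p : ord_graph 6 r := Ordinal (isT : 5 < 6).
  have noP (C : {set ord_graph 6 r}) : mincyc C -> C \subset ~: [set p].
    move=> mC; apply/subsetP=> u uC; rewrite !inE; apply/eqP=> up.
    have := mincyc_deg mC uC; suff : deg u C <= 1 by lia.
    apply: deg_le1 => v w _ _; rewrite up /= /ord_adj /upper_adj /r /= => pv pw.
    have := ltn_ord v; have := ltn_ord w; move: pv pw => pv pw v6 w6; apply: (@ord_inj 6); lia.
  apply: no_two_cycP => -[A [B [_ _ dAB cA cB]]].
  have [C sCA mC] := mincyc_exists cA; have [D sDB mD] := mincyc_exists cB.
  have dCD : [disjoint C & D] by apply: disjointWl sCA (disjointWr sDB dAB).
  have : #|C :|: D| <= #|~: [set p]|.
    by apply: subset_leq_card; rewrite subUset !noP.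
  have := cardT_C1 p; rewrite card_ord_graph card_disjU //.
  by have := mincyc_card mC; have := mincyc_card mD; lia.
move=> nr; have i0 : 0 < i by move: nr; rewrite /r; lia.
have j5 : j = 5 by move: nr; rewrite /r; lia.
exists [in [:: i; 0; j]],
  [in [:: if i == 1 then 2 else 1; if i <= 2 then 3 else 2; if i == 4 then 3 else 4]].
split; rewrite ?inE ?eqxx ?orbT //.
- by move=> v; rewrite !inE; case: (i =P 1) => ?; case: (leqP i 2) => ?; case: (i =P 4) => ?; lia.
- apply: (@ord_tight _ _ _ 0 id); rewrite ?inE ?eqxx ?orbT //.
  move=> v vn; rewrite !inE => vP v0; exists 0; rewrite !inE eqxx orbT.
  by rewrite /upper_adj /r; split; lia.
- by apply: ord_triangle; rewrite /r; case: (i =P 1) => ?; case: (leqP i 2) => ?; case: (i =P 4) => ?; lia.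
Qed.

End PendantK5.

(** * The spectrum: both inclusions *)

Lemma ESP n m : ES n (cycles_ge3 2) m <->
  exists G : sgraph, [/\ #|G| = n, sat G & darts [set: G] = 2 * m].
Proof.
split=> -[G [Gn sG Gm]]; exists G; split=> //; first exact/saturatedP.
- by rewrite darts_edges Gm.
- exact/saturatedP.
- by move: Gm; rewrite darts_edges; lia.
Qed.

Lemma ES_ord n r m : sat (ord_graph n r) ->
  \sum_(0 <= j < n) \sum_(0 <= i < j) r i j = m -> ES n (cycles_ge3 2) m.
Proof.
move=> satr <-; apply/ESP; exists (ord_graph n r).
by rewrite card_ord_graph darts_ord_graph.
Qed.

Lemma ES_joined_triangle n t : 3 <= t <= n - 3 -> ES n (cycles_ge3 2) (n + 2 * t).
Proof.
case/andP=> t3 tn; exact: ES_ord (joined_triangle_sat t3 tn) (joined_triangle_sum t3 tn).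
Qed.

Lemma ES_pendant_wheel n m : n + 5 <= m <= 2 * n - 2 -> ES n (cycles_ge3 2) m.
Proof.
(* The rim length is l = m - n; as l is at most n - 2, the vertex l + 1 exists and there are n + l =
   m edges. *)
move=> nm; have l5 : 5 <= m - n by lia.
have ln : m - n < n by lia.
apply: ES_ord (pendant_wheel_sat l5 ln) _; rewrite pendant_wheel_sum //.
by case: eqP; lia.
Qed.

Lemma ES_spectrum n m : 5 < n -> ES n (cycles_ge3 2) m ->
  [\/ exists2 t, 3 <= t <= n - 3 & m = n + 2 * t, n + 5 <= m <= 2 * n - 2 |
      n = 6 /\ (m = 10 \/ m = 11)].
Proof.
move=> n6 /ESP[G [Gn satG Gm]].
have G6 : 5 < #|G| by rewrite Gn.
have := sat_spectrum satG G6; rewrite /edge_spectrum Gn Gm.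
case=> [[k k3 dk]|d|[-> d]].
- by apply: Or31; exists k => //; lia.
- by apply: Or32; lia.
- by apply: Or33; split=> //; lia.
Qed.

Theorem theorem1p4 :
  (forall m : nat, ES 6 (cycles_ge3 2) m <-> 10 <= m <= 12) /\
  (forall n : nat, 7 <= n ->
    (forall m : nat, ES n (cycles_ge3 2) m <->
       n + 5 <= m <= 2 * n - 2 \/
       (exists2 t : nat, 3 <= t <= n - 3 & m = n + 2 * t)) /\
    (forall m : nat, n + 5 <= m <= 3 * n - 6 ->
       (ES n (cycles_ge3 2) m <->
          n + 5 <= m <= 2 * n - 2 \/ ~~ odd (m - n)))).
Proof.
split=> [m|n n7].
  split=> [/(@ES_spectrum 6 m isT)[[t t3 ->]||[_ [->|->]]] //|m1012]; try by lia.
  have [->|m10] := eqVneq m 10.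
    exact: ES_ord (@pendant_wheel_sat 6 5 isT isT) (@pendant_wheel_sum 6 5 isT isT).
  have [->|m11] := eqVneq m 11; first exact: ES_ord pendant_K5_sat pendant_K5_sum.
  have -> : m = 6 + 2 * 3 by lia.
  exact: ES_joined_triangle.
have spectrum m : ES n (cycles_ge3 2) m <->
    n + 5 <= m <= 2 * n - 2 \/ exists2 t, 3 <= t <= n - 3 & m = n + 2 * t.
  split=> [/ES_spectrum-/(_ (ltnW n7))[|mn|[n6 _]]|[|[t tn ->]]].
  - by right.
  - by left.
  - by rewrite n6 in n7.
  - exact: ES_pendant_wheel.
  - exact: ES_joined_triangle.
split=> // m mn; split=> [/spectrum[mn'|[t tn mt]]|[mn'|even]].
- by left.
- by right; rewrite mt; lia.
- by apply/spectrum; left.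
(* For m - n even, m >= n + 5 forces half of it to be at least 3, and m <= 3n - 6 makes it at most n
   - 3. *)
by apply/spectrum; right; exists ((m - n)./2); lia.
Qed.
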